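(* Let $(X_t,t\ge0)$ be a CBI$(\Psi,\Phi)$ process with $\Phi\not\equiv 0$. (a) In the critical or subcritical case ($\Psi'(0+)\ge 0$), the process is recurrent or transient according as $$\int_{0}^{1}\frac{\mathrm dz}{\Psi(z)}\exp \left[ -\int_{z}^{1}\frac{\Phi(x)} {\Psi(x)} \,\mathrm dx\right]=+ \infty \quad\text{ or }\quad < + \infty.$$ (b) In the supercritical case ($\Psi'(0+)<0$), the process is transient.
   Context: Mechanisms: $\Psi(q)=\gamma q+\frac{1}{2}\sigma^{2}q^{2}+\int_{0}^{\infty}(e^{-qu}-1+qu\mathbf 1_{\{u\in (0,1)\}})\pi(\mathrm du)$ and $\Phi(q)=bq+\int_{0}^{\infty}(1-e^{-qu})\nu(\mathrm du)$ for $q\ge 0$, where $\sigma,b\ge 0$, $\gamma\in\mathbb R$, and $\pi,\nu$ are measures on $(0,\infty)$ with $\int_0^\infty(1\wedge u^2)\pi(\mathrm du)<\infty$ and $\int_0^\infty(1\wedge u)\nu(\mathrm du)<\infty$. A CBI$(\Psi,\Phi)$ process (continuous-state branching process with immigration) is the càdlàg Feller process $(X_t,t\ge0)$ with values in $\mathbb R_+=[0,\infty)$ (in case of explosion, $\infty$ is added as an absorbing state) such that for $q>0$, $x\ge 0$, $\mathbb{E}_{x}[e^{-qX_{t}}]=\exp\left(-xv_{t}(q)-\int_{0}^{t}\Phi(v_{s}(q))\,\mathrm ds\right)$, where $\frac{\partial v_t(q)}{\partial t}=-\Psi(v_t(q))$, $v_0(q)=q$. $\mathbb P_x$ is the law of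 the process started at $x$. Standing assumptions: at least one of $\sigma\neq 0$, $\pi\not\equiv0$, $\nu\not\equiv 0$ holds, and there exists $q\ge0$ with $\Psi(q)>0$. $\Psi$ is subcritical, critical, supercritical according as $\Psi'(0+)>0$, $=0$, $<0$ (where $\Psi'(0+)=-\infty$ is allowed in the supercritical case). The process is recurrent if there exists $x\in\mathbb R_+$ such that $\mathbb{P}_{x}(\liminf_{t\to\infty}|X_{t}-x|=0)=1$. It is transient if $\mathbb{P}_{x}(\lim_{t\to\infty}X_{t}=\infty)=1$ for every $x\in\mathbb R_+$. *)

(* Defs.v *)
From mathcomp Require Import all_boot all_order all_algebra.
From mathcomp Require Import all_classical all_reals all_analysis.
From mathcomp Require Import measurable_realfun.

Set Implicit Arguments.
Unset Strict Implicit.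
Unset Printing Implicit Defensive.

Import Order.TTheory GRing.Theory Num.Theory.
Import numFieldNormedType.Exports.

Local Open Scope classical_set_scope.
Local Open Scope ring_scope.

(** A measure on (0, oo) is represented by a Borel measure on R of which only
    the restriction to `]0, +oo[ is ever used. *)

Section Mechanisms.
Context {R : realType}.
Implicit Types mu : {measure set (measurableTypeR R) -> \bar R}.

Definition branching_levy_measure mu : Prop :=
  (\int[mu]_(u in `]0%R, +oo[) (Num.min 1 (u ^+ 2))%:E < +oo)%E.

Definition immigration_levy_measure mu : Prop :=
  (\int[mu]_(u in `]0%R, +oo[) (Num.min 1 u)%:E < +oo)%E.

Definition branching_mechanism (gamma sigma : R) mu (q : R) : R :=
  gamma * q + 2^-1 * sigma ^+ 2 * q ^+ 2 +
  \int[mu]_(u in `]0, +oo[)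
     (expR (- (q * u)) - 1 + q * u * \1_(`]0, 1[%classic : set R) u).

Definition immigration_mechanism (b : R) mu (q : R) : R :=
  b * q + \int[mu]_(u in `]0, +oo[) (1 - expR (- (q * u))).

(** [Psi'(0+)]; a Lévy-Khintchine [Psi] is convex and differentiable on
    (0, oo), so that the limit exists in [-oo, +oo). *)
Definition derive_at_0p (Psi : R -> R) : \bar R :=
  lim (((derive1 Psi q)%:E : \bar R) @[q --> 0^'+]).

(** [v t q] is the value at time [t] of the solution started from [q]. The
    derivative at [t = 0] is the right derivative, and the solution has to stay
    in the domain [0, oo) of [Psi]. *)
Definition cumulant_flow (Psi : R -> R) (v : R -> R -> R) : Prop :=
  forall q : R, 0 < q ->
  [/\ v 0 q = q,
      forall t : R, 0 <= t -> 0 <= v t q,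
      h^-1 * (v h q - v 0 q) @[h --> 0^'+] --> - Psi (v 0 q) &
      forall t : R, 0 < t -> is_derive t 1 (v ^~ q) (- Psi (v t q))].

End Mechanisms.

(** Processes [X] indexed by [0, oo) with values in [0, +oo], under a family of
    laws [P y], where [y] is the starting point. Since the index type is [R] and
    the state type is [\bar R], values at negative times and laws [P y] with
    [y < 0] are irrelevant. *)

Section Processes.
Context {R : realType} {d : measure_display} {Omega : measurableType d}.
Variables (X : R -> Omega -> \bar R) (P : \bar R -> probability Omega R).

Definition state_space : set (\bar R) := [set y | (0 <= y)%E].

Definition natural_filtration (s : R) : set (set Omega) :=
  <<s [set A | exists (r : R) (B : set (\bar R)),
         [/\ 0 <= r <= s, measurable B & A = X r @^-1` B]] >>.

Definition cadlag_paths : Prop :=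
  forall w,
  (forall t : R, 0 <= t -> X s w @[s --> t^'+] --> X t w) /\
  (forall t : R, 0 < t -> cvg (X s w @[s --> t^'-])).

(** The transition function is [y, B |-> P y (X t @^-1` B)], and the Markov
    property is relative to the natural filtration of [X]. *)
Record markov_process : Prop := {
  markov_measurable : forall t : R, 0 <= t -> measurable_fun setT (X t);
  markov_state : forall (t : R) w, 0 <= t -> state_space (X t w);
  markov_start : forall y, state_space y -> P y (X 0 @^-1` [set y]) = 1%E;
  markov_kernel : forall (t : R) (B : set (\bar R)), 0 <= t -> measurable B ->
    measurable_fun state_space (fun y => P y (X t @^-1` B));
  markov_property : forall (y : \bar R) (s t : R) (A : set Omega)
      (B : set (\bar R)), state_space y -> 0 <= s -> 0 <= t ->
    natural_filtration s A -> measurable B ->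
    P y (A `&` X (s + t) @^-1` B) =
      (\int[P y]_(w in A) P (X s w) (X t @^-1` B))%E;
}.

Definition absorbed_at_infinity : Prop :=
  forall (s t : R) w, 0 <= s -> s <= t -> X s w = +oo%E -> X t w = +oo%E.

(** [C_0([0, oo))], as the continuous functions on [0, +oo] that vanish at the
    cemetery point [+oo]. *)
Definition C0_fun (f : \bar R -> R) : Prop :=
  {within state_space, continuous f} /\ f +oo%E = 0.

Definition semigroup (t : R) (f : \bar R -> R) (y : \bar R) : R :=
  \int[P y]_w f (X t w).

Definition feller : Prop :=
  forall f, C0_fun f ->
  (forall t : R, 0 <= t -> C0_fun (semigroup t f)) /\
  (forall eps : R, 0 < eps -> \forall t \near 0^'+,
     forall y, state_space y -> `|semigroup t f y - f y| <= eps).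

(** [expeR -oo = 0], so that the event of explosion does not contribute. *)
Definition CBI_laplace (Psi Phi : R -> R) : Prop :=
  exists2 v : R -> R -> R, cumulant_flow Psi v &
  forall q x t : R, 0 < q -> 0 <= x -> 0 <= t ->
  (\int[P x%:E]_w expeR (- (q%:E * X t w)) =
   (expR (- (x * v t q)
          - \int[lebesgue_measure]_(s in `[0, t]) Phi (v s q)))%:E)%E.

Record CBI (Psi Phi : R -> R) : Prop := {
  CBI_markov : markov_process;
  CBI_absorbed : absorbed_at_infinity;
  CBI_feller : feller;
  CBI_cadlag : cadlag_paths;
  CBI_transform : CBI_laplace Psi Phi;
}.

Definition recurrent : Prop :=
  exists2 x : R, 0 <= x &
  {ae P x%:E, forall w,
     limf_einf (fun t => `|X t w - x%:E|%E) (pinfty_nbhs R) = 0%E}.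

Definition transient : Prop :=
  forall x : R, 0 <= x ->
  {ae P x%:E, forall w, X t w @[t --> +oo%R] --> +oo%E}.

End Processes.

(* Main.v *)
Require Import Defs.
From mathcomp Require Import all_boot all_order all_algebra.
From mathcomp Require Import all_classical all_reals all_analysis.
From mathcomp Require Import measurable_realfun.
From mathcomp Require Import ring lra.

Set Implicit Arguments.
Unset Strict Implicit.
Unset Printing Implicit Defensive.

Import Order.TTheory GRing.Theory Num.Theory.
Import numFieldNormedType.Exports.

Local Open Scope classical_set_scope.
Local Open Scope ring_scope.

(** Write [e_q] for the function [y |-> exp (- q y)] on [[0, +oo]], with value
    [0] at [+oo], and [J_t(q)] for the integral of [Phi (v s q)] over
    [s] in [[0, t]]. The formula that defines a CBI process says that its
    semigroup maps [e_q] to [exp (- J_t(q)) e_(v t q)]. Exponentials are thus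
    stable under the semigroup, and the process enters the proof through the
    Markov property on exponentials and through the right-continuity of its
    paths. The arguments are of potential theory and are run along discrete time
    grids, on finite sums of exponentials.

    Transience. Let [g >= 0] be decreasing with [P_t g <= g] and such that the
    expectation of [g (X_t)] tends to [0]. The maximal inequality bounds the
    probability that [X] visits [[0, a)] after time [t] by the ratio of the
    expectation of [g (X_t)] to [g a], hence [X_t] tends to infinity. If [Psi] is
    supercritical, it changes sign at a point [rho > 0], which is a rest point
    of the flow; then [g = e_rho] has expectation
    [exp (- rho x - t Phi rho)] ([rest_point_transient]). If [Psi] is critical
    or subcritical, [g] is the potential of [e_1]; at [0] it equals the integral
    of [exp (- J_t(1))] over all times [t], and the substitution [z = v t 1]
    identifies that integral with the one of the theorem ([occupation_cvg]). When
    it is finite, [occupation_transient] applies.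

    Recurrence. As [Phi] is concave and [Psi] convex, [Phi / Psi] decreases to
    its infimum [xb] ([bottom_level]). From [Phi >= xb Psi] one gets
    [J_t(q) >= xb (q - v t q)], so that [E e_q(X_t) <= exp (- q xb)] for all [q]
    if [X_0 = xb]: the process stays above [xb] ([above_bottom_level]). Let now
    [a > xb]. For suitable [Z < K] and [dl] with [v dl K = Z], the function
    [e_K] satisfies [P_dl e_K - e_K >= c e_Z] on [[a, +oo]], so that the
    expected sum of [e_Z] along the skeleton [X_(n dl)], collected before it
    enters [[0, a)], is at most [1 / c] ([lyapunov_bound]). If the integral of
    the theorem is infinite, then the sum of the expectations of
    [e_Z (X_(n dl))] diverges, at the same rate from all starting points since
    [v t Z] tends to [0]. Decomposing it at the entrance in [[0, a)]
    ([first_passage_bound]) then forces that entrance to happen almost surely,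
    after any given time ([survival_small]). Therefore the lower limit of [X] is
    [xb] almost surely. *)

(** * The Levy-Khintchine mechanisms *)

Section RealInequalities.
Context {R : realType}.
Implicit Types x a b u : R.

Lemma expRN_le1 x : 0 <= x -> expR (- x) <= 1.
Proof. by move=> x0; rewrite -[leRHS]expR0 ler_expR oppr_le0. Qed.

Lemma onem_expRN_le x : 1 - expR (- x) <= x.
Proof. by have := expR_ge1Dx (- x); lra. Qed.

Lemma expRN_second_order x : 0 <= x -> 0 <= expR (- x) - 1 + x <= x ^+ 2.
Proof.
move=> x0; have h1 := expR_ge1Dx (- x); have h2 := expR_ge1Dx x.
apply/andP; split; first lra.
rewrite expRN; have h3 : (expR x)^-1 <= (1 + x)^-1.
  by rewrite lef_pV2 // posrE ?expR_gt0//; lra.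
suff : (1 + x)^-1 - 1 + x <= x ^+ 2 by lra.
have -> : (1 + x)^-1 - 1 + x = x ^+ 2 / (1 + x) by field; lra.
by rewrite ler_pdivrMr; [nra|lra].
Qed.

(** A concave function that vanishes at [0], here [x |-> 1 - exp (- x)], has
    nonincreasing slopes from [0]. Integrated, this gives the monotonicity of
    both [Psi q / q] and [Phi q / q]. *)
Lemma onem_expRN_ratio a b u : 0 <= a -> a <= b -> 0 <= u ->
  a * (1 - expR (- (b * u))) <= b * (1 - expR (- (a * u))).
Proof.
move=> a0 ab u0.
have [b0|b0] := leP b 0; first by have -> : b = a by lra.
have t0 : 0 <= a / b by rewrite divr_ge0// ltW.
have t1 : a / b <= 1 by rewrite ler_pdivrMr// mul1r.
have := @convex_expR R (Itv01 t0 t1) (- (b * u)) 0.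
rewrite !convRE/= expR0 mulr0 addr0 mulr1 /unstable.onem.
have -> : a / b * - (b * u) = - (a * u) by field; lra.
move=> h.
have : b * expR (- (a * u)) <= b * (a / b * expR (- (b * u)) + (1 - a / b)).
  by rewrite ler_pM2l.
have -> : b * (a / b * expR (- (b * u)) + (1 - a / b)) =
  a * expR (- (b * u)) + b - a by field; lra.
lra.
Qed.

End RealInequalities.

Lemma integrable_dominated {d} {T : measurableType d} {R : realType}
    (mu : {measure set T -> \bar R}) (D : set T) (f g : T -> R) :
  measurable D -> measurable_fun D f -> (forall x, D x -> `|f x| <= g x) ->
  mu.-integrable D (EFin \o g) -> mu.-integrable D (EFin \o f).
Proof.
move=> mD mf fg; apply: le_integrable => //; first exact/measurable_EFinP.
by move=> x Dx; rewrite /= lee_fin (le_trans (fg _ Dx))// ler_norm.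
Qed.

Lemma integrable_scale {d} {T : measurableType d} {R : realType}
    (mu : {measure set T -> \bar R}) (D : set T) (f : T -> R) (k : R) :
  measurable D -> mu.-integrable D (EFin \o f) ->
  mu.-integrable D (EFin \o (fun x => k * f x)).
Proof.
move=> mD i; have := integrableZl mD k i.
by apply: eq_integrable => // x _; rewrite /= EFinM.
Qed.

Section BranchingMechanism.
Context {R : realType}.
Variable mu : {measure set (measurableTypeR R) -> \bar R}.
Hypothesis mu_levy : branching_levy_measure mu.
Variables gamma sigma : R.
Let D : set (measurableTypeR R) := `]0, +oo[%classic.
Let f (q u : R) : R :=
  expR (- (q * u)) - 1 + q * u * \1_(`]0, 1[%classic : set R) u.
Let Psi := branching_mechanism gamma sigma mu.

Let indE (u : R) : 0 < u -> \1_(`]0, 1[%classic : set R) u = ((u < 1)%R : bool)%:R :> R.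
Proof. by move=> u0; rewrite indicE mem_setE in_itv/= u0. Qed.

Let DP (u : R) : D u -> 0 < u.
Proof. by rewrite /D/= in_itv/= andbT. Qed.

Let mD : measurable D. Proof. exact: measurable_itv. Qed.

Let mind : measurable_fun D
  (\1_(`]0, 1[%classic : set (measurableTypeR R)) : measurableTypeR R -> R).
Proof. by apply: measurable_indic; exact: measurable_itv. Qed.

Let mf (q : R) : measurable_fun D (f q : measurableTypeR R -> R).
Proof.
apply: measurable_funD.
  apply: measurable_funB => //; apply: measurableT_comp => //.
  by apply: measurable_funN; apply: measurable_funM.
by apply: measurable_funM => //; apply: measurable_funM.
Qed.

Let G (u : R) : R := Num.min 1 (u ^+ 2).

Let G0 (u : R) : 0 <= G u.
Proof. by rewrite /G le_min ler01 sqr_ge0. Qed.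

Let GE1 (u : R) : 0 <= u -> u < 1 -> G u = u ^+ 2.
Proof. by move=> u0 u1; rewrite /G; apply/min_idPr; nra. Qed.

Let GE2 (u : R) : 1 <= u -> G u = 1.
Proof. by move=> u1; rewrite /G; apply/min_idPl; nra. Qed.

Let mG : measurable_fun D (G : measurableTypeR R -> R).
Proof. by apply: measurable_minr => //; exact: measurable_funX. Qed.

Let iG : mu.-integrable D (EFin \o G).
Proof.
apply/integrableP; split; first exact/measurable_EFinP.
under eq_integral do rewrite /= ger0_norm//.
exact: mu_levy.
Qed.

Let iGk (k : R) : mu.-integrable D (EFin \o (fun u => k * G u)).
Proof. exact: integrable_scale. Qed.

Let f_bound (Q q u : R) : 0 <= q -> q <= Q -> D u -> `|f q u| <= (1 + Q ^+ 2) * G u.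
Proof.
move=> q0 qQ /DP u0; rewrite /f indE//.
have [u1|u1] := ltP u 1.
  rewrite mulr1 (GE1 (ltW u0) u1).
  have /andP[h1 h2] := expRN_second_order (mulr_ge0 q0 (ltW u0)).
  rewrite ger0_norm//; apply: le_trans h2 _.
  by rewrite exprMn ler_wpM2r ?sqr_ge0//; nra.
rewrite mulr0 addr0 GE2// mulr1.
have h1 := expRN_le1 (mulr_ge0 q0 (ltW u0)); have h2 := expR_ge0 (- (q * u)).
by rewrite ler_norml; apply/andP; split; nra.
Qed.

Let if_ (q : R) : 0 <= q -> mu.-integrable D (EFin \o f q).
Proof.
by move=> q0; apply: (integrable_dominated mD (mf q) _ (iGk (1 + q ^+ 2))) => u Du;
  exact: f_bound.
Qed.

Lemma branching_mechanism0 : Psi 0 = 0.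
Proof.
rewrite /Psi /branching_mechanism mulr0 expr0n/= mulr0 !add0r.
rewrite (@eq_Rintegral _ _ _ _ _ (cst 0)) ?Rintegral_cst ?mul0r//.
by move=> u _; rewrite !mul0r oppr0 expR0 subrr add0r.
Qed.

(** Freezing [Psi] on the negative half-line gives a function that is
    continuous on the whole line; continuity at [0] included, this is the
    form in which it composes with the flow. *)
Lemma branching_mechanism_continuous :
  continuous (fun q : R => Psi (Num.max q 0)).
Proof.
have cmax : continuous (fun q : R => Num.max q 0).
  by move=> x; apply: continuous_max; [exact: cvg_id|exact: cvg_cst].
move=> q; rewrite /Psi /branching_mechanism.
apply: cvgD.
  apply: cvgD; first by apply: cvgMr; exact: cmax.
  by apply: cvgMr; apply: cvgM; exact: cmax.
pose Q := `|q| + 1.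
have := @continuity_under_integral R _ _ mu (fun q u => f (Num.max q 0) u) D mD
  (- Q) Q _ _ _ (iGk (1 + Q ^+ 2)) _ q.
apply.
- by move=> x _; apply: if_; rewrite le_max lexx orbT.
- apply: aeW => u Du x _; rewrite /f.
  have cm : (fun y : R => Num.max y 0 * u) @ x --> Num.max x 0 * u.
    by apply: cvgMl; exact: cmax.
  apply: cvgD; last exact: cvgMl.
  apply: cvgB; last exact: cvg_cst.
  apply: (@continuous_comp _ _ _ (fun x : R => - (Num.max x 0 * u)) expR).
    by apply: cvgN.
  exact: continuous_expR.
- move=> x; rewrite /= in_itv/= => /andP[_ xQ]; apply: aeW => u Du.
  apply: f_bound => //; first by rewrite le_max lexx orbT.
  by rewrite ge_max (ltW xQ) /Q; have := normr_ge0 q; lra.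
- by rewrite inE/= in_itv/= /Q; have := ler_norm q; have := ler_norm (- q);
    rewrite normrN; lra.
Qed.

(** Convexity of [Psi], from [Psi 0 = 0]. *)
Lemma branching_mechanism_ratio (a b : R) : 0 <= a -> a <= b ->
  b * Psi a <= a * Psi b.
Proof.
move=> a0 ab; have b0 : 0 <= b by lra.
rewrite /Psi /branching_mechanism !mulrDr -!RintegralZl//; [|exact: if_..].
apply: lerD.
  have : 0 <= sigma ^+ 2 by exact: sqr_ge0.
  have : 0 <= a * b * (b - a) by rewrite !mulr_ge0// subr_ge0.
  nra.
apply: le_Rintegral => //.
- by apply: integrable_scale => //; exact: if_.
- by apply: integrable_scale => //; exact: if_.
move=> u /DP u0; rewrite /f.
have := onem_expRN_ratio a0 ab (ltW u0).
lra.
Qed.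

Let f2 (z u : R) : 0 <= z -> f z u - 2 * f (z / 2) u = (1 - expR (- (z / 2 * u))) ^+ 2.
Proof.
move=> z0; rewrite /f.
have -> : expR (- (z * u)) = expR (- (z / 2 * u)) ^+ 2.
  by rewrite -expRM_natl; congr expR; field.
by field.
Qed.

(** A second difference of [Psi] at [0] is a Gaussian term plus an integral of
    squares: it vanishes only if [Psi] is linear. *)
Lemma branching_mechanism_linear (z : R) : 0 < z -> Psi z = 0 -> Psi (z / 2) = 0 ->
  sigma = 0 /\ mu D = 0%E.
Proof.
move=> z0 hz hz2; have z20 : 0 <= z / 2 by lra.
have i1 := if_ (ltW z0); have i2 := if_ z20.
have i3 : mu.-integrable D (EFin \o (fun u => 2 * f (z / 2) u)).
  exact: integrable_scale.
have eI : \int[mu]_(u in D) ((1 - expR (- (z / 2 * u))) ^+ 2) =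
    \int[mu]_(u in D) f z u - 2 * \int[mu]_(u in D) f (z / 2) u.
  rewrite -RintegralZl// -RintegralB//.
  by apply: eq_Rintegral => u _; rewrite f2// ltW.
have I0 : 0 <= \int[mu]_(u in D) ((1 - expR (- (z / 2 * u))) ^+ 2).
  by apply: Rintegral_ge0 => u _; rewrite sqr_ge0.
have s2 : 0 <= sigma ^+ 2 * z ^+ 2 by rewrite mulr_ge0// sqr_ge0.
have E : 4^-1 * (sigma ^+ 2 * z ^+ 2) +
    \int[mu]_(u in D) ((1 - expR (- (z / 2 * u))) ^+ 2) = 0.
  rewrite eI; transitivity (Psi z - 2 * Psi (z / 2)); last by rewrite hz hz2; lra.
  by rewrite /Psi /branching_mechanism -/D -/(f _ _); field.
have sz : sigma ^+ 2 * z ^+ 2 = 0 by lra.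
have J0 : \int[mu]_(u in D) ((1 - expR (- (z / 2 * u))) ^+ 2) = 0 by lra.
split.
  by move/eqP: sz; rewrite mulf_eq0 !sqrf_eq0 (gt_eqF z0) orbF => /eqP.
have mh : measurable_fun D (fun u : measurableTypeR R => ((1 - expR (- (z / 2 * u))) ^+ 2)%:E).
  apply/measurable_EFinP; apply: measurable_funX; apply: measurable_funB => //.
  apply: measurableT_comp => //; apply: measurable_funN.
  exact: measurable_funM.
have ih : mu.-integrable D (EFin \o (fun u => (1 - expR (- (z / 2 * u))) ^+ 2)).
  have := integrableB mD i1 i3; apply: eq_integrable => // u _ /=.
  by rewrite -EFinB f2// ltW.
have : (\int[mu]_(u in D) ((1 - expR (- (z / 2 * u))) ^+ 2)%:E)%E = 0%E.
  by rewrite -(fineK (integrable_fin_num mD ih)) -/(Rintegral _ _ _) J0.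
have -> : (\int[mu]_(u in D) ((1 - expR (- (z / 2 * u))) ^+ 2)%:E)%E =
   (\int[mu]_(u in D) `|((1 - expR (- (z / 2 * u))) ^+ 2)%:E|)%E.
  by apply: eq_integral => u _; rewrite gee0_abs// lee_fin sqr_ge0.
move/(ae_eq_integral_abs mu mD mh) => [N [mN N0 sN]].
apply/eqP; rewrite -measure_le0 -N0; apply: le_measure; rewrite ?inE//.
move=> u Du; apply: sN => /= /(_ Du)/eqP.
have : expR (- (z / 2 * u)) < 1.
  by rewrite expR_lt1 oppr_lt0 mulr_gt0// ?divr_gt0//; exact: DP.
rewrite eqe sqrf_eq0 subr_eq0 => /[swap] /eqP <-.
by rewrite ltxx.
Qed.

Let h (q u : R) : R :=
  u * \1_(`]0, 1[%classic : set R) u - u * expR (- (q * u)).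

Let derf (u q : R) : is_derive q 1 (f ^~ u) (h q u).
Proof.
rewrite /f /h; apply: is_derive_eq; rewrite /GRing.scale/=; ring.
Qed.

Let partial_f (q u : R) : partial1of2 f q u = h q u.
Proof. by rewrite partial1of2E; have [_ ->] := derf u q. Qed.

Let h_bound (p Q q u : R) : 0 < p -> p <= q -> q <= Q -> D u ->
  `|h q u| <= (Q + p^-1) * G u.
Proof.
move=> p0 pq qQ /DP u0; rewrite /h indE//.
have p10 : 0 < p^-1 by rewrite invr_gt0.
have qu0 : 0 <= q * u by rewrite mulr_ge0 ?ltW//; lra.
have h1 := expRN_le1 qu0; have h2 := expR_ge0 (- (q * u)).
have h3 := onem_expRN_le (q * u).
have [u1|u1] := ltP u 1.
  (* small jumps: 1 - exp (- q u) is at most q u *)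
  rewrite mulr1 (GE1 (ltW u0) u1) ger0_norm; last by nra.
  apply: (@le_trans _ _ (q * u ^+ 2)); first by nra.
  by rewrite ler_wpM2r ?sqr_ge0//; lra.
(* large jumps: q u exp (- q u) is at most 1 *)
rewrite mulr0 sub0r normrN GE2// mulr1 ger0_norm; last by rewrite mulr_ge0// ltW.
apply: (@le_trans _ _ p^-1); last by lra.
have h4 : q * u * expR (- (q * u)) <= 1.
  rewrite expRN ler_pdivrMr ?expR_gt0// mul1r.
  by have := expR_ge1Dx (q * u); lra.
rewrite -(@ler_pM2l _ p)// mulfV; last by rewrite gt_eqF.
by apply: le_trans h4; rewrite mulrA ler_wpM2r// ler_wpM2r// ltW.
Qed.

Let mh (q : R) : measurable_fun D (h q : measurableTypeR R -> R).
Proof.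
apply: measurable_funB; apply: measurable_funM => //.
apply: measurableT_comp => //.
by apply: measurable_funN; apply: measurable_funM.
Qed.

Let ih (q : R) : 0 < q -> mu.-integrable D (EFin \o h q).
Proof.
by move=> q0; apply: (integrable_dominated mD (mh q) _ (iGk (q + q^-1))) => u Du;
  exact: h_bound.
Qed.

Let dPsi (q : R) : R := gamma + sigma ^+ 2 * q + \int[mu]_(u in D) h q u.

Let is_derive_jumps (q : R) : 0 < q ->
  is_derive q 1 (fun q => \int[mu]_(u in D) f q u) (\int[mu]_(u in D) h q u).
Proof.
move=> q0.
have q2 : 0 < q / 2 by lra.
have Iq : `]q / 2, (q + 1)[%classic q by rewrite /= in_itv/=; apply/andP; split; lra.
have Ix (x : R) : `]q / 2, (q + 1)[%classic x -> q / 2 <= x /\ x <= q + 1.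
  by rewrite /= in_itv/= => /andP[? ?]; split; exact: ltW.
have i1 (x : R) : `]q / 2, (q + 1)[%classic x -> mu.-integrable D (EFin \o f x).
  by move=> /Ix[? _]; apply: if_; lra.
have i2 (x u : R) : `]q / 2, (q + 1)[%classic x -> D u -> derivable (f ^~ u) x 1.
  by move=> _ _; have [] := derf u x.
pose G' u := (q + 1 + (q / 2)^-1) * G u.
have G'0 u : 0 <= G' u.
  have : 0 < (q / 2)^-1 by rewrite invr_gt0.
  by move=> ?; rewrite mulr_ge0//; lra.
have i3 (x u : R) : `]q / 2, (q + 1)[%classic x -> D u ->
    `|partial1of2 f x u| <= G' u.
  by move=> /Ix[? ?] Du; rewrite partial_f; exact: h_bound.
have dF := derivable_under_integral mD Iq i1 i2 G'0 (iGk _) i3.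
have F1 := differentiation_under_integral mD Iq i1 i2 G'0 (iGk _) i3.
apply: DeriveDef => //.
rewrite -derive1E F1.
by apply: eq_Rintegral => u _; rewrite -partial_f.
Qed.

Lemma is_derive_branching_mechanism (q : R) : 0 < q -> is_derive q 1 Psi (dPsi q).
Proof.
move=> q0; rewrite /Psi /branching_mechanism.
have := is_derive_jumps q0 => ?.
apply: is_derive_eq.
by rewrite /dPsi /GRing.scale/=; field.
Qed.

Lemma branching_mechanism_derivable (q : R) : 0 < q -> derivable Psi q 1.
Proof. by move=> q0; have [] := is_derive_branching_mechanism q0. Qed.

(** Convexity of [Psi]; the right limit of the derivative at [0] therefore
    exists in [[-oo, +oo)]. *)
Lemma branching_mechanism_derive_nondecreasing (p q : R) : 0 < p -> p <= q ->
  derive1 Psi p <= derive1 Psi q.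
Proof.
move=> p0 pq; have q0 : 0 < q by lra.
have [_ pE] := is_derive_branching_mechanism p0.
have [_ qE] := is_derive_branching_mechanism q0.
rewrite !derive1E pE qE /dPsi; apply: lerD.
  by rewrite lerD2l ler_wpM2l// sqr_ge0.
apply: le_Rintegral => //; [exact: ih|exact: ih|move=> u /DP u0].
rewrite /h lerD2l lerN2 ler_pM2l// ler_expR lerN2.
by rewrite ler_wpM2r// ltW.
Qed.

End BranchingMechanism.

Lemma within_max0_continuous {R : realType} (g : R -> R) (a b : R) : 0 <= a ->
  continuous (fun x : R => g (Num.max x 0)) -> {within `[a, b], continuous g}.
Proof.
move=> a0 cg; apply: (@subspace_eq_continuous _ _ _ (fun x : R => g (Num.max x 0))).
  move=> x; rewrite inE/= in_itv/= => /andP[ax _].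
  by congr g; apply/max_idPl; exact: le_trans ax.
exact: continuous_subspaceT.
Qed.

Section ImmigrationMechanism.
Context {R : realType}.
Variable mu : {measure set (measurableTypeR R) -> \bar R}.
Hypothesis mu_levy : immigration_levy_measure mu.
Variable b : R.
Hypothesis b0 : 0 <= b.
Let D : set (measurableTypeR R) := `]0, +oo[%classic.
Let f (q u : R) : R := 1 - expR (- (q * u)).
Let Phi := immigration_mechanism b mu.

Let DP (u : R) : D u -> 0 < u.
Proof. by rewrite /D/= in_itv/= andbT. Qed.

Let mD : measurable D. Proof. exact: measurable_itv. Qed.

Let mf (q : R) : measurable_fun D (f q : measurableTypeR R -> R).
Proof.
apply: measurable_funB => //; apply: measurableT_comp => //.
by apply: measurable_funN; apply: measurable_funM.
Qed.

Let G (u : R) : R := Num.min 1 u.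

Let mG : measurable_fun D (G : measurableTypeR R -> R).
Proof. exact: measurable_minr. Qed.

Let iG : mu.-integrable D (EFin \o G).
Proof.
apply/integrableP; split; first exact/measurable_EFinP.
rewrite (@eq_integral _ _ _ _ _ (fun u : measurableTypeR R => (G u)%:E));
  first exact: mu_levy.
move=> u /set_mem/DP u0; rewrite /= ger0_norm//.
by rewrite /G le_min ler01 ltW.
Qed.

Let iGk (k : R) : mu.-integrable D (EFin \o (fun u => k * G u)).
Proof. exact: integrable_scale. Qed.

Let f_ge0 (q u : R) : 0 <= q -> D u -> 0 <= f q u.
Proof.
by move=> q0 /DP u0; rewrite subr_ge0; apply: expRN_le1; rewrite mulr_ge0// ltW.
Qed.

Let f_bound (Q q u : R) : 0 <= q -> q <= Q -> D u -> `|f q u| <= (1 + Q) * G u.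
Proof.
move=> q0 qQ Du; rewrite ger0_norm ?f_ge0//; have u0 := DP Du.
have h1 := onem_expRN_le (q * u); have h2 := expR_ge0 (- (q * u)).
rewrite /f /G; case: (leP 1 u) => u1.
  by rewrite mulr1; lra.
by apply: le_trans h1 _; rewrite ler_wpM2r ?ltW//; lra.
Qed.

Let if_ (q : R) : 0 <= q -> mu.-integrable D (EFin \o f q).
Proof.
by move=> q0; apply: (integrable_dominated mD (mf q) _ (iGk (1 + q))) => u Du;
  exact: f_bound.
Qed.

Lemma immigration_mechanism_ge0 (q : R) : 0 <= q -> 0 <= Phi q.
Proof.
move=> q0; rewrite /Phi /immigration_mechanism addr_ge0// ?mulr_ge0//.
by apply: Rintegral_ge0 => u Du; exact: f_ge0.
Qed.

Lemma immigration_mechanism0 : Phi 0 = 0.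
Proof.
rewrite /Phi /immigration_mechanism mulr0 add0r.
rewrite (@eq_Rintegral _ _ _ _ _ (cst 0)) ?Rintegral_cst ?mul0r//.
by move=> u _; rewrite !mul0r oppr0 expR0 subrr.
Qed.

Lemma immigration_mechanism_nondecreasing (p q : R) : 0 <= p -> p <= q ->
  Phi p <= Phi q.
Proof.
move=> p0 pq; have q0 : 0 <= q by lra.
rewrite /Phi /immigration_mechanism; apply: lerD; first by rewrite ler_wpM2l.
apply: le_Rintegral => //; [exact: if_|exact: if_|move=> u /DP u0].
by rewrite lerD2l lerN2 ler_expR lerN2 ler_wpM2r// ltW.
Qed.

Lemma immigration_mechanism_continuous :
  continuous (fun q : R => Phi (Num.max q 0)).
Proof.
have cmax : continuous (fun q : R => Num.max q 0).
  by move=> x; apply: continuous_max; [exact: cvg_id|exact: cvg_cst].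
move=> q; rewrite /Phi /immigration_mechanism.
apply: cvgD; first by apply: cvgMr; exact: cmax.
pose Q := `|q| + 1.
have := @continuity_under_integral R _ _ mu (fun q u => f (Num.max q 0) u) D mD
  (- Q) Q _ _ _ (iGk (1 + Q)) _ q.
apply.
- by move=> x _; apply: if_; rewrite le_max lexx orbT.
- apply: aeW => u Du x _; rewrite /f.
  apply: cvgB; first exact: cvg_cst.
  apply: (@continuous_comp _ _ _ (fun x : R => - (Num.max x 0 * u)) expR).
    by apply: cvgN; apply: cvgMl; exact: cmax.
  exact: continuous_expR.
- move=> x; rewrite /= in_itv/= => /andP[_ xQ]; apply: aeW => u Du.
  apply: f_bound => //; first by rewrite le_max lexx orbT.
  by rewrite ge_max (ltW xQ) /Q; have := normr_ge0 q; lra.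
- by rewrite inE/= in_itv/= /Q; have := ler_norm q; have := ler_norm (- q);
    rewrite normrN; lra.
Qed.

(** Concavity of [Phi], from [Phi 0 = 0]. *)
Lemma immigration_mechanism_ratio (p q : R) : 0 <= p -> p <= q ->
  p * Phi q <= q * Phi p.
Proof.
move=> p0 pq; have q0 : 0 <= q by lra.
rewrite /Phi /immigration_mechanism !mulrDr -(RintegralZl p mD (if_ q0)).
rewrite -(RintegralZl q mD (if_ p0)).
apply: lerD; first by lra.
apply: le_Rintegral => //.
- by apply: integrable_scale => //; exact: if_.
- by apply: integrable_scale => //; exact: if_.
by move=> u /DP u0; exact: onem_expRN_ratio p0 pq (ltW u0).
Qed.

Lemma immigration_mechanism_gt0 : (exists2 q, 0 <= q & Phi q <> 0) ->
  forall q, 0 < q -> 0 < Phi q.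
Proof.
move=> [p p0 Pp] q q0.
have p1 : 0 < p.
  rewrite lt_neqAle p0 andbT; apply/eqP => p00.
  by apply: Pp; rewrite -p00 immigration_mechanism0.
have Pp0 : 0 < Phi p.
  by rewrite lt_neqAle eq_sym immigration_mechanism_ge0// andbT; exact/eqP.
have [pq|qp] := leP p q.
  exact: lt_le_trans Pp0 (immigration_mechanism_nondecreasing p0 pq).
have := immigration_mechanism_ratio (ltW q0) (ltW qp).
have : 0 < q * Phi p by rewrite mulr_gt0.
move=> h1 h2; rewrite -(pmulr_rgt0 _ p1); exact: lt_le_trans h2.
Qed.

End ImmigrationMechanism.

Section DriftAtZero.
Context {R : realType}.
Variable mu : {measure set (measurableTypeR R) -> \bar R}.
Hypothesis mu_levy : branching_levy_measure mu.
Variables gamma sigma : R.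
Let Psi := branching_mechanism gamma sigma mu.

Let dPsi_cvg : (derive1 Psi q)%:E @[q --> 0^'+] --> derive_at_0p Psi.
Proof.
apply: nondecreasing_at_right_is_cvge; near=> e => x y.
rewrite !in_itv/= => /andP[x0 _] /andP[y0 _] xy; rewrite lee_fin.
exact: branching_mechanism_derive_nondecreasing.
Unshelve. all: by end_near. Qed.

Let derive_at_0p_le (q : R) : 0 < q -> (derive_at_0p Psi <= (derive1 Psi q)%:E)%E.
Proof.
move=> q0; apply: (lime_le (cvgP _ dPsi_cvg)); near=> x; rewrite lee_fin.
apply: branching_mechanism_derive_nondecreasing => //.
near: x; exact: nbhs_right_le.
Unshelve. all: by end_near. Qed.

Let MVT_Psi (q : R) : 0 < q -> exists2 c, 0 < c <= q & Psi q = derive1 Psi c * q.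
Proof.
move=> q0.
have [|c] := MVT q0 _ (within_max0_continuous (lexx 0)
   (@branching_mechanism_continuous _ _ mu_levy gamma sigma)) (df := derive1 Psi).
  move=> x; rewrite in_itv/= => /andP[x0 _].
  apply: DeriveDef; first exact: branching_mechanism_derivable.
  by rewrite derive1E.
rewrite in_itv/= => /andP[c0 cq] E; exists c; first by rewrite c0 ltW.
by move: E; rewrite (branching_mechanism0 mu gamma sigma) !subr0.
Qed.

Lemma supercritical_neg : (derive_at_0p Psi < 0)%E -> exists2 z, 0 < z & Psi z < 0.
Proof.
move=> h.
have [q q0 dq] : exists2 q, 0 < q & derive1 Psi q < 0.
  apply: contrapT => H; move: h; apply/negP; rewrite -leNgt.
  apply: (lime_ge (cvgP _ dPsi_cvg)); near=> x; rewrite lee_fin leNgt.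
  by apply/negP => H'; apply: H; exists x.
exists q => //.
have [c /andP[c0 cq] ->] := MVT_Psi q0.
rewrite (pmulr_llt0 _ q0); apply: le_lt_trans dq.
exact: (@branching_mechanism_derive_nondecreasing _ _ mu_levy gamma sigma).
Unshelve. all: by end_near. Qed.

(** [Psi] is nonnegative since its derivative is. If it vanished at some [z >
    0], it would vanish on [[0, z]] by convexity, be linear by
    [branching_mechanism_linear], and hence be zero. *)
Lemma subcritical_gt0 : (0 <= derive_at_0p Psi)%E -> (exists2 q, 0 <= q & 0 < Psi q) ->
  forall z, 0 < z -> 0 < Psi z.
Proof.
move=> h [p p0 Pp].
have Pge0 q : 0 < q -> 0 <= Psi q.
  move=> q0; have [c /andP[c0 cq] ->] := MVT_Psi q0.
  rewrite mulr_ge0// ?(ltW q0)// -lee_fin; apply: le_trans h _.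
  exact: derive_at_0p_le.
move=> z z0; rewrite lt_neqAle Pge0// andbT; apply/eqP => Pz.
have Pz2 : Psi (z / 2) = 0.
  apply/eqP; rewrite eq_le Pge0 ?divr_gt0// andbT.
  have := @branching_mechanism_ratio R mu mu_levy gamma sigma (z / 2) z.
  rewrite -/Psi -Pz mulr0 (pmulr_rle0 _ z0); apply; lra.
have [s0 m0] := branching_mechanism_linear mu_levy z0 (esym Pz) Pz2.
have PE q : Psi q = gamma * q.
  rewrite /Psi /branching_mechanism s0 expr0n/= mulr0 mul0r addr0 /Rintegral.
  have mD : measurable (`]0, +oo[%classic : set (measurableTypeR R)).
    exact: measurable_itv.
  rewrite (null_set_integral mD _ m0) ?addr0//.
  apply/measurable_EFinP; apply: measurable_funD.
    apply: measurable_funB => //; apply: measurableT_comp => //.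
    by apply: measurable_funN; apply: measurable_funM.
  apply: measurable_funM; first by apply: measurable_funM.
  by apply: measurable_indic; exact: measurable_itv.
have g0 : gamma = 0.
  by move: Pz; rewrite PE => /esym/eqP; rewrite mulf_eq0 (gt_eqF z0) orbF => /eqP.
by move: Pp; rewrite PE g0 mul0r ltxx.
Qed.

End DriftAtZero.

(** * The flow *)

Section RealAnalysis.
Context {R : realType}.
Implicit Types (f df : R -> R) (a b : R).
Notation leb := (@lebesgue_measure R).

Lemma is_derive_le0_le f df a b : a <= b ->
  (forall x, x \in `]a, b[ -> is_derive x 1 f (df x)) ->
  (forall x, x \in `]a, b[ -> df x <= 0) ->
  {within `[a, b], continuous f} -> f b <= f a.
Proof.
rewrite le_eqVlt => /predU1P[->//|ab] fdf df0 cf.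
have [c cab E] := MVT ab fdf cf.
by rewrite -subr_le0 E mulr_le0_ge0 ?df0// subr_ge0 ltW.
Qed.

Lemma is_derive_ge0_le f df a b : a <= b ->
  (forall x, x \in `]a, b[ -> is_derive x 1 f (df x)) ->
  (forall x, x \in `]a, b[ -> 0 <= df x) ->
  {within `[a, b], continuous f} -> f a <= f b.
Proof.
rewrite le_eqVlt => /predU1P[->//|ab] fdf df0 cf.
have [c cab E] := MVT ab fdf cf.
by rewrite -subr_ge0 E mulr_ge0 ?df0// subr_ge0 ltW.
Qed.

Lemma continuous_within f (A : set R) : continuous f -> {within A, continuous f}.
Proof. by move=> cf; exact: continuous_subspaceT. Qed.

Lemma continuous_integrable_itv f a b : {within `[a, b], continuous f} ->
  leb.-integrable `[a, b] (EFin \o f).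
Proof. by move=> cf; apply: continuous_compact_integrable => //; exact: segment_compact. Qed.

Lemma is_derive_integral f a b : continuous f -> a < b ->
  is_derive b 1 (fun t => \int[leb]_(s in `[a, t]) f s) (f b).
Proof.
move=> cf ab.
have ii : leb.-integrable `[a, b + 1] (EFin \o f).
  by apply: continuous_integrable_itv; exact: continuous_within.
have b1 : b < b + 1 by rewrite ltrDl.
have [dF FE] := continuous_FTC1_closed b1 ii ab (cf b).
by apply: DeriveDef; [exact: dF|rewrite -derive1E FE].
Qed.

Lemma integral_within_continuous f a b : continuous f -> a <= b ->
  {within `[a, b], continuous (fun t => \int[leb]_(s in `[a, t]) f s)}.
Proof.
move=> cf ab; apply: (parameterized_integral_continuous ab).
by apply: continuous_integrable_itv; exact: continuous_within.
Qed.

End RealAnalysis.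

(** The flow [v] of [dv/dt = - Psi v], and [J t q], the exponent contributed by
    immigration. *)
Section Flow.
Context {R : realType}.
Variables (Psi Phi : R -> R) (v : R -> R -> R).
Hypothesis vflow : cumulant_flow Psi v.
Hypothesis Phi_continuous : continuous (fun q : R => Phi (Num.max q 0)).
Notation leb := (@lebesgue_measure R).

Definition immigration_exponent (t q : R) : R :=
  \int[leb]_(s in `[0, t]) Phi (v s q).
Local Notation J := immigration_exponent.

Section OneTrajectory.
Variable q : R.
Hypothesis q0 : 0 < q.

Lemma flow0 : v 0 q = q. Proof. by have [] := vflow q0. Qed.

Lemma flow_ge0 t : 0 <= t -> 0 <= v t q.
Proof. by have [_ h _ _] := vflow q0; exact: h. Qed.

Lemma is_derive_flow (t : R) : 0 < t -> is_derive t 1 (v ^~ q) (- Psi (v t q)).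
Proof. by have [_ _ _ h] := vflow q0; exact: h. Qed.

(** The trajectory frozen at [q] for negative times, so as to be continuous on
    the whole line. *)
Let V (t : R) : R := v (Num.max t 0) q.

Let VE (t : R) : 0 <= t -> V t = v t q.
Proof. by move=> t0; rewrite /V; congr (v _ q); exact/max_idPl. Qed.

Let V_continuous : continuous V.
Proof.
move=> t; have [t0|t0|->] := ltgtP t 0.
- apply/cvgrPdist_lt => e e0; near=> s.
  have s0 : s <= 0 by apply: ltW; near: s; exact: lt_nbhsl.
  by rewrite /V; move/max_idPr : (s0) => ->; move/max_idPr : (ltW t0) => ->;
    rewrite subrr normr0.
- have [d _] := is_derive_flow t0.
  have c : {for t, continuous (v ^~ q)}.
    exact/differentiable_continuous/derivable1_diffP.
  rewrite /prop_for /continuous_at VE ?ltW//.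
  apply: cvg_trans c; apply: near_eq_cvg; near=> s.
  by rewrite VE// ltW//; near: s; exact: lt_nbhsr.
- have [_ _ hd _] := vflow q0.
  have hr : v h q @[h --> 0^'+] --> v 0 q.
    have hh : (h * (h^-1 * (v h q - v 0 q)) + v 0 q) @[h --> (0:R)^'+] -->
        0 * - Psi (v 0 q) + v 0 q.
      apply: cvgD; last exact: cvg_cst.
      by apply: cvgM hd; apply: cvg_at_right_filter; exact: cvg_id.
    move: hh; rewrite mul0r add0r; apply: cvg_trans; apply: near_eq_cvg.
    near=> h; have h0 : h != 0 by rewrite gt_eqF//; near: h; exact: nbhs_right_gt.
    by rewrite mulrA mulfV// mul1r subrK.
  apply/left_right_continuousP; split; rewrite VE//.
    have cc : (fun=> v 0 q) s @[s --> (0:R)^'-] --> v 0 q by exact: cvg_cst.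
    apply: cvg_trans cc; apply: near_eq_cvg; near=> s.
    have s0 : s <= 0 by near: s; exact: nbhs_left_le.
    by rewrite /V; move/max_idPr : s0 => ->.
  apply: cvg_trans hr; apply: near_eq_cvg; near=> s.
  by rewrite VE// ltW//; near: s; exact: nbhs_right_gt.
Unshelve. all: by end_near. Qed.

Lemma flow_within_continuous (a b : R) : 0 <= a ->
  {within `[a, b], continuous (v ^~ q)}.
Proof.
by move=> a0; apply: (@within_max0_continuous _ (v ^~ q)) => //; exact: V_continuous.
Qed.

Let phi (s : R) : R := Phi (Num.max (V s) 0).

Let phiE (s : R) : 0 <= s -> phi s = Phi (v s q).
Proof. by move=> s0; rewrite /phi VE//; congr Phi; apply/max_idPl; exact: flow_ge0. Qed.

Let phi_continuous : continuous phi.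
Proof.
move=> t; apply: (@continuous_comp _ _ _ V (fun q : R => Phi (Num.max q 0))).
  exact: V_continuous.
exact: Phi_continuous.
Qed.

Let JE (t : R) : J t q = \int[leb]_(s in `[0, t]) phi s.
Proof.
apply: eq_Rintegral => s; rewrite inE/= in_itv/= => /andP[s0 _].
by rewrite phiE.
Qed.

Lemma immigration_exponent0 : J 0 q = 0.
Proof. by rewrite /J set_itv1 Rintegral_set1. Qed.

Lemma is_derive_immigration_exponent (t : R) : 0 < t ->
  is_derive t 1 (J ^~ q) (Phi (v t q)).
Proof.
move=> t0; rewrite -phiE ?ltW//.
rewrite (_ : J ^~ q = (fun t => \int[leb]_(s in `[0, t]) phi s)); last first.
  by apply/funext => s; exact: JE.
exact: is_derive_integral.
Qed.

Lemma immigration_exponent_within_continuous (a b : R) : 0 <= a ->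
  {within `[a, b], continuous (J ^~ q)}.
Proof.
move=> a0; have [ab|ba] := leP a b; last first.
  by rewrite set_itv_ge ?bnd_simp -?ltNge//; exact: continuous_subspace0.
rewrite (_ : J ^~ q = (fun t => \int[leb]_(s in `[0, t]) phi s)); last first.
  by apply/funext => s; exact: JE.
have ss : `[a, b]%classic `<=` `[0, b]%classic.
  by apply: subset_itvr; rewrite bnd_simp.
apply: (continuous_subspaceW ss).
by apply: integral_within_continuous => //; exact: le_trans ab.
Qed.

(** The derivative of [J t q + k * v t q] is [Phi (v t q) - k * Psi (v t q)]. *)
Lemma immigration_exponent_le (k a b : R) : 0 <= a -> a <= b ->
  (forall s, a < s -> s < b -> Phi (v s q) <= k * Psi (v s q)) ->
  J b q - J a q <= k * (v a q - v b q).
Proof.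
move=> a0 ab h.
have : J b q + k * v b q <= J a q + k * v a q.
  apply: (@is_derive_le0_le _ (fun t => J t q + k * v t q)
    (fun t => Phi (v t q) + k * - Psi (v t q))) => //.
  - move=> x; rewrite in_itv/= => /andP[ax xb].
    have x0 : 0 < x by lra.
    have := is_derive_immigration_exponent x0 => ?.
    have := is_derive_flow x0 => ?.
    apply: is_derive_eq; rewrite /GRing.scale/=; ring.
  - by move=> x; rewrite in_itv/= => /andP[ax xb]; have := h _ ax xb; lra.
  - apply: within_continuousD; first exact: immigration_exponent_within_continuous.
    move=> x; apply: cvgMr; exact: flow_within_continuous.
lra.
Qed.

Lemma immigration_exponent_ge (k a b : R) : 0 <= a -> a <= b ->
  (forall s, a < s -> s < b -> k * Psi (v s q) <= Phi (v s q)) ->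
  k * (v a q - v b q) <= J b q - J a q.
Proof.
move=> a0 ab h.
have : J a q + k * v a q <= J b q + k * v b q.
  apply: (@is_derive_ge0_le _ (fun t => J t q + k * v t q)
    (fun t => Phi (v t q) + k * - Psi (v t q))) => //.
  - move=> x; rewrite in_itv/= => /andP[ax xb].
    have x0 : 0 < x by lra.
    have := is_derive_immigration_exponent x0 => ?.
    have := is_derive_flow x0 => ?.
    apply: is_derive_eq; rewrite /GRing.scale/=; ring.
  - by move=> x; rewrite in_itv/= => /andP[ax xb]; have := h _ ax xb; lra.
  - apply: within_continuousD; first exact: immigration_exponent_within_continuous.
    move=> x; apply: cvgMr; exact: flow_within_continuous.
lra.
Qed.

Lemma immigration_exponent_nondecreasing (a b : R) :
  (forall z, 0 <= z -> 0 <= Phi z) -> 0 <= a -> a <= b -> J a q <= J b q.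
Proof.
move=> Phi0 a0 ab; rewrite -subr_ge0 -[leLHS](mul0r (v a q - v b q)).
apply: immigration_exponent_ge => // s sa sb; rewrite mul0r; apply/Phi0/flow_ge0.
lra.
Qed.

End OneTrajectory.

(** The squared distance of the trajectory to [rho] decreases in time. *)
Lemma flow_rest_point (rho t : R) : 0 < rho -> 0 <= t ->
  (forall z, 0 <= z -> z <= rho -> Psi z <= 0) ->
  (forall z, rho <= z -> 0 <= Psi z) -> v t rho = rho.
Proof.
move=> r0 t0 h1 h2.
have : (v t rho - rho) ^+ 2 <= (v 0 rho - rho) ^+ 2.
  apply: (@is_derive_le0_le _ (fun s => (v s rho - rho) ^+ 2)
     (fun s => 2 * (v s rho - rho) * - Psi (v s rho))) => //.
  - move=> x; rewrite in_itv/= => /andP[x0 xb].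
    have := is_derive_flow r0 x0 => ?.
    apply: is_derive_eq; rewrite /GRing.scale/=; ring.
  - move=> x; rewrite in_itv/= => /andP[x0 xb].
    have vx := flow_ge0 r0 (ltW x0).
    have [vr|rv] := leP (v x rho) rho.
      by have := h1 _ vx vr; nra.
    by have := h2 _ (ltW rv); nra.
  - move=> x; apply: cvgM; apply: cvgB; try exact: cvg_cst.
      exact: flow_within_continuous.
    exact: flow_within_continuous.
rewrite flow0// subrr expr0n/= => h.
by apply/eqP; rewrite -subr_eq0 -sqrf_eq0 eq_le h sqr_ge0.
Qed.

End Flow.

Section SubcriticalFlow.
Context {R : realType}.
Variables (Psi : R -> R) (v : R -> R -> R).
Hypothesis vflow : cumulant_flow Psi v.
Hypothesis Psi_continuous : continuous (fun q : R => Psi (Num.max q 0)).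
Hypothesis Psi0 : Psi 0 = 0.
Hypothesis Psi_ratio : forall a b : R, 0 <= a -> a <= b -> b * Psi a <= a * Psi b.
Hypothesis Psi_gt0 : forall z : R, 0 < z -> 0 < Psi z.
Notation leb := (@lebesgue_measure R).
Variable q : R.
Hypothesis q0 : 0 < q.

Let Psi_ge0 (z : R) : 0 <= z -> 0 <= Psi z.
Proof.
rewrite le_eqVlt => /predU1P[<-|z0]; first by rewrite Psi0.
by rewrite ltW// Psi_gt0.
Qed.

Lemma flow_nonincreasing (a b : R) : 0 <= a -> a <= b -> v b q <= v a q.
Proof.
move=> a0 ab.
apply: (@is_derive_le0_le _ (v ^~ q) (fun t => - Psi (v t q))) => //.
- move=> x; rewrite in_itv/= => /andP[ax xb]; apply: (is_derive_flow vflow) => //.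
  exact: le_lt_trans ax.
- move=> x; rewrite in_itv/= => /andP[ax xb]; rewrite oppr_le0.
  by apply/Psi_ge0/(flow_ge0 vflow) => //; rewrite ltW// (le_lt_trans a0).
- exact: (flow_within_continuous vflow q0 a0).
Qed.

Lemma flow_le (t : R) : 0 <= t -> v t q <= q.
Proof. by move=> t0; rewrite -[leRHS](flow0 vflow q0) flow_nonincreasing. Qed.

(** [Psi z <= (Psi q / q) z] on [[0, q]], so that the flow decays at most
    exponentially and never reaches [0]. *)
Lemma flow_gt0 (t : R) : 0 <= t -> 0 < v t q.
Proof.
move=> t0; pose C := Psi q / q.
suff h : expR (C * 0) * v 0 q <= expR (C * t) * v t q.
  have : 0 < expR (C * t) * v t q.
    apply: lt_le_trans h; rewrite mulr0 expR0 mul1r (flow0 vflow q0)//.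
  by rewrite pmulr_rgt0// expR_gt0.
apply: (@is_derive_ge0_le _ (fun t => expR (C * t) * v t q)
  (fun t => expR (C * t) * (C * v t q - Psi (v t q)))) => //.
- move=> x; rewrite in_itv/= => /andP[x0 xb].
  have := is_derive_flow vflow q0 x0 => ?.
  apply: is_derive_eq; rewrite /GRing.scale/=; ring.
- move=> x; rewrite in_itv/= => /andP[x0 xb].
  rewrite mulr_ge0 ?expR_ge0// subr_ge0 /C mulrAC ler_pdivlMr// mulrC [leRHS]mulrC.
  by apply: Psi_ratio; [exact: (flow_ge0 vflow q0 (ltW x0))|exact/flow_le/ltW].
- move=> x; apply: cvgM; last exact: (flow_within_continuous vflow q0 (lexx 0)).
  apply: (@continuous_within _ (fun t => expR (C * t))) => y.
  apply: (@continuous_comp _ _ _ (fun t => C * t) expR).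
    by apply: cvgMr; exact: cvg_id.
  exact: continuous_expR.
Qed.

Lemma flow_decreasing (a b : R) : 0 <= a -> a < b -> v b q < v a q.
Proof.
move=> a0 ab.
have [|c] := @MVT R (v ^~ q) (fun t => - Psi (v t q)) a b ab _
   (flow_within_continuous vflow q0 a0).
  move=> x; rewrite in_itv/= => /andP[ax xb]; apply: (is_derive_flow vflow) => //.
  exact: le_lt_trans ax.
rewrite in_itv/= => /andP[ac cb] /= E.
rewrite -subr_lt0 E mulNr oppr_lt0 mulr_gt0 ?subr_gt0// Psi_gt0// flow_gt0//.
by rewrite ltW// (le_lt_trans a0).
Qed.

(** While the trajectory is above [c], its speed is at least [Psi c]. *)
Lemma flow_small (c : R) : 0 < c -> exists2 T : R, 0 <= T & v T q < c.
Proof.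
move=> c0; apply: contrapT => H.
have hc (t : R) : 0 <= t -> c <= v t q.
  by move=> t0; rewrite leNgt; apply/negP => h; apply: H; exists t.
pose T := q / Psi c.
have T0 : 0 <= T by rewrite divr_ge0// ltW// Psi_gt0.
suff h : v T q + Psi c * T <= v 0 q + Psi c * 0.
  have : 0 < v T q by exact: flow_gt0.
  have PT : Psi c * T = q by rewrite /T mulrC divfK// gt_eqF// Psi_gt0.
  by move: h; rewrite (flow0 vflow q0) PT; lra.
apply: (@is_derive_le0_le _ (fun t => v t q + Psi c * t)
  (fun t => - Psi (v t q) + Psi c)) => //.
- move=> x; rewrite in_itv/= => /andP[x0 xb].
  have := is_derive_flow vflow q0 x0 => ?.
  apply: is_derive_eq; rewrite /GRing.scale/=; ring.
- move=> x; rewrite in_itv/= => /andP[x0 xb].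
  have cx := hc x (ltW x0).
  have := Psi_ratio (ltW c0) cx; have := Psi_gt0 c0 => p0 h.
  suff : Psi c <= Psi (v x q) by lra.
  by rewrite -(ler_pM2l c0); apply: le_trans h; rewrite ler_wpM2r// ltW.
- apply: within_continuousD; first exact: (flow_within_continuous vflow q0 (lexx 0)).
  apply: (@continuous_within _ (fun t => Psi c * t)) => y.
  by apply: cvgMr; exact: cvg_id.
Qed.

Lemma flow_onto (z : R) : 0 < z -> z < q -> exists2 T : R, 0 < T & v T q = z.
Proof.
move=> z0 zq; have [T T0 Tz] := flow_small z0.
have [|c] := @IVT R (v ^~ q) 0 T z T0 (flow_within_continuous vflow q0 (lexx 0)).
  by rewrite (flow0 vflow q0) ge_min (ltW Tz) orbT le_max (ltW zq).
rewrite in_itv/= => /andP[c0 cT] E; exists c => //.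
rewrite lt_neqAle c0 andbT; apply/eqP => c00.
by move: zq; rewrite -E -c00 (flow0 vflow q0) ltxx.
Qed.

Let V_right_cvg (a : R) : 0 <= a -> v x q @[x --> a^'+] --> v a q.
Proof.
move=> a0; have a1 : a < a + 1 by rewrite ltrDl.
by have [_ ? _] := (continuous_within_itvP _ a1).1
  (flow_within_continuous vflow q0 a0).
Qed.

Let V_left_cvg (a : R) : 0 < a -> v x q @[x --> a^'-] --> v a q.
Proof.
move=> a0.
have [c _ cr] := (continuous_within_itvP _ a0).1
  (flow_within_continuous vflow q0 (lexx 0)); exact: cr.
Qed.

Let V_cvg (a : R) : 0 < a -> v x q @[x --> a] --> v a q.
Proof.
by move=> a0; apply/left_right_continuousP; split; [exact: V_left_cvg|exact/V_right_cvg/ltW].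
Qed.

Let Psi_flow_cvg (F : set_system R) (FF : Filter F) (a : R) : 0 <= a ->
  v x q @[x --> F] --> v a q -> (\forall x \near F, 0 <= x) ->
  Psi (v x q) @[x --> F] --> Psi (v a q).
Proof.
move=> a0 cF F0.
have maxv (x : R) : 0 <= x -> Num.max (v x q) 0 = v x q.
  by move=> x0; apply/max_idPl; exact: (flow_ge0 vflow q0 x0).
have h : Psi (Num.max (v x q) 0) @[x --> F] --> Psi (v a q).
  rewrite -[X in _ --> Psi X](maxv _ a0).
  apply: (@cvg_comp _ _ _ (fun x => v x q) (fun y => Psi (Num.max y 0)) _ _ _ cF).
  exact: Psi_continuous.
apply: cvg_trans h; apply: near_eq_cvg; near=> x; rewrite maxv//.
by near: x.
Unshelve. all: by end_near. Qed.

Lemma flow_substitution (g : R -> R) (T : R) : 0 <= T ->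
  {within `[v T q, q], continuous g} ->
  (\int[leb]_(z in `[v T q, q]) (g z)%:E =
   \int[leb]_(t in `[0%R, T]) (g (v t q) * Psi (v t q))%:E)%E.
Proof.
move=> T0 cg.
have dV (x : R) : 0 < x -> derive1 (v ^~ q) x = - Psi (v x q).
  by move=> x0; rewrite derive1E; have [_ ->] := is_derive_flow vflow q0 x0.
have := T0; rewrite le_eqVlt => /predU1P[T00|T00].
  by rewrite -T00 (flow0 vflow q0) !set_itv1 !integral_set1.
have mD : measurable (`]0, T[%classic : set (measurableTypeR R)).
  exact: measurable_itv.
have cgV : {within `]0, T[, continuous (fun t => g (v t q) * Psi (v t q))}.
  apply: continuous_in_subspaceT => x; rewrite inE/= in_itv/= => /andP[x0 xT].
  apply: cvgM.
    have cx : g z @[z --> v x q] --> g (v x q).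
      have vTq : v T q < q by rewrite -[ltRHS](flow0 vflow q0) flow_decreasing.
      have [h _ _] := (continuous_within_itvP _ vTq).1 cg.
      apply: h; rewrite in_itv/= flow_decreasing ?(ltW x0)//=.
      by rewrite -[ltRHS](flow0 vflow q0) flow_decreasing.
    exact: (cvg_comp _ _ (V_cvg x0) cx).
  apply: Psi_flow_cvg (ltW x0) (V_cvg x0) _.
  by near=> y; rewrite ltW//; near: y; exact: lt_nbhsr.
have mgV : measurable_fun (`]0, T[%classic : set (measurableTypeR R))
    (fun t : measurableTypeR R => (g (v t q) * Psi (v t q))%:E).
  by apply/measurable_EFinP; apply: subspace_continuous_measurable_fun.
have E (t : R) : `]0, T[%classic t ->
    (((g \o v ^~ q) * - (derive1 (v ^~ q))) t)%:E = (g (v t q) * Psi (v t q))%:E.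
  move=> /=; rewrite in_itv/= => /andP[t0 _].
  by congr EFin; rewrite /= /GRing.mul/= /GRing.opp/= dV// opprK.
have -> : (\int[leb]_(z in `[v T q, q]) (g z)%:E =
    \int[leb]_(z in `[v T q, v 0 q]) (g z)%:E)%E by rewrite (flow0 vflow q0).
rewrite (@integration_by_substitution_decreasing R (v ^~ q) g 0 T T0).
- rewrite (@integral_itv_bndoo _ 0 T _ true false); last first.
    by apply: (eq_measurable_fun _ _ mgV) => t /set_mem /E.
  rewrite (@integral_itv_bndoo _ 0 T _ true false)//.
  by apply: eq_integral => t /set_mem /E.
- move=> x y; rewrite !in_itv/= => /andP[x0 _] /andP[y0 _] xy.
  exact: flow_decreasing.
- move=> x; rewrite in_itv/= => /andP[x0 _].
  have x0' : \forall y \near x, 0 < y by exact: lt_nbhsr.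
  have h : - Psi (v y q) @[y --> x] --> - Psi (v x q).
    apply: cvgN; apply: Psi_flow_cvg (ltW x0) (V_cvg x0) _.
    by near=> y; rewrite ltW//; near: y.
  rewrite /continuous_at dV//; apply: cvg_trans h; apply: near_eq_cvg.
  by near=> y; rewrite dV//; near: y.
- apply/cvg_ex; exists (- Psi (v 0 q)).
  have h : - Psi (v y q) @[y --> 0^'+] --> - Psi (v 0 q).
    apply: cvgN; apply: Psi_flow_cvg (lexx 0) (V_right_cvg (lexx 0)) _.
    exact: nbhs_right_ge.
  apply: cvg_trans h; apply: near_eq_cvg.
  by near=> y; rewrite dV//; near: y; exact: nbhs_right_gt.
- apply/cvg_ex; exists (- Psi (v T q)).
  have T0' : \forall y \near T^'-, 0 < y by exact: nbhs_left_gt.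
  have h : - Psi (v y q) @[y --> T^'-] --> - Psi (v T q).
    apply: cvgN; apply: Psi_flow_cvg (ltW T00) (V_left_cvg T00) _.
    by near=> y; rewrite ltW//; near: y.
  apply: cvg_trans h; apply: near_eq_cvg.
  by near=> y; rewrite dV//; near: y.
- split; [|exact: V_right_cvg|exact: V_left_cvg].
  move=> x; rewrite in_itv/= => /andP[x0 _].
  by have [] := is_derive_flow vflow q0 x0.
- by rewrite (flow0 vflow q0).
Unshelve. all: by end_near. Qed.

End SubcriticalFlow.

(** * The integral test along the flow *)

Lemma within_continuous_expRN {R : realType} (f : R -> R) (A : set R) :
  {within A, continuous f} -> {within A, continuous (fun x => expR (- f x))}.
Proof.
move=> cf; apply: (@within_continuous_comp _ _ _ A f (fun y => expR (- y))) cf.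
move=> y _; apply: (@continuous_comp _ _ _ (fun y : R => - y) expR).
  by apply: cvgN; exact: cvg_id.
exact: continuous_expR.
Qed.

Section Potential.
Context {R : realType}.
Variables (Psi Phi : R -> R) (v : R -> R -> R).
Hypothesis vflow : cumulant_flow Psi v.
Hypothesis Psi_continuous : continuous (fun q : R => Psi (Num.max q 0)).
Hypothesis Phi_continuous : continuous (fun q : R => Phi (Num.max q 0)).
Hypothesis Psi0 : Psi 0 = 0.
Hypothesis Psi_ratio : forall a b : R, 0 <= a -> a <= b -> b * Psi a <= a * Psi b.
Hypothesis Psi_gt0 : forall z : R, 0 < z -> 0 < Psi z.
Hypothesis Phi_ge0 : forall z : R, 0 <= z -> 0 <= Phi z.
Notation leb := (@lebesgue_measure R).
Local Notation J := (immigration_exponent Phi v).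
Let r (z : R) : R := Phi z / Psi z.

Let vgt0 (t : R) : 0 <= t -> 0 < v t 1.
Proof. by apply: flow_gt0 vflow Psi0 Psi_ratio Psi_gt0 _ ltr01 _. Qed.

Let vle1 (t : R) : 0 <= t -> v t 1 <= 1.
Proof. by apply: flow_le vflow Psi0 Psi_gt0 _ ltr01 _. Qed.

Let vdecr (s t : R) : 0 <= s -> s <= t -> v t 1 <= v s 1.
Proof. by apply: flow_nonincreasing vflow Psi0 Psi_gt0 _ ltr01 _ _. Qed.

Let r_within (a b : R) : 0 < a -> {within `[a, b], continuous r}.
Proof.
move=> a0.
have maxE (z : R) : 0 < z -> Num.max z 0 = z by move=> z0; apply/max_idPl/ltW.
apply: continuous_in_subspaceT => z; rewrite inE/= in_itv/= => /andP[az _].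
have z0 : 0 < z by exact: lt_le_trans az.
have h : Phi (Num.max y 0) / Psi (Num.max y 0) @[y --> z] --> r z.
  rewrite /r -[in X in _ --> X](maxE _ z0); apply: cvgM; first exact: Phi_continuous.
  by apply: cvgV; [rewrite maxE// gt_eqF// Psi_gt0|exact: Psi_continuous].
apply: cvg_trans h; apply: near_eq_cvg; near=> y; rewrite maxE//.
near: y; exact: lt_nbhsr.
Unshelve. all: by end_near. Qed.

(** [F z] in the integral test, whose value along the flow is [J]. *)
Let F (z : R) : R := \int[leb]_(x in `[z, 1]) r x.

Let F_flow (t : R) : 0 <= t -> F (v t 1) = J t 1.
Proof.
move=> t0; rewrite /F /J /Rintegral; congr fine.
rewrite (flow_substitution vflow Psi_continuous Psi0 Psi_ratio Psi_gt0 ltr01 t0).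
  apply: eq_integral => s; rewrite inE/= in_itv/= => /andP[s0 _].
  by rewrite /r divfK// gt_eqF// Psi_gt0// vgt0.
by apply: r_within; exact: vgt0.
Qed.

Let F_within (a : R) : 0 < a -> a <= 1 -> {within `[a, 1], continuous F}.
Proof.
move=> a0 a1.
have ir : leb.-integrable `[a, 1] (EFin \o r).
  by apply: continuous_integrable_itv; exact: r_within.
have FE (z : R) : z \in `[a, 1] -> F a - \int[leb]_(x in `[a, z]) r x = F z.
  rewrite in_itv/= => /andP[az z1]; rewrite /F (Rintegral_itvB ir) ?bnd_simp//.
  rewrite Rintegral_itv_obnd_cbnd//; apply: integrableS ir => //.
  by apply: subset_itvr; rewrite bnd_simp.
apply: (@subspace_eq_continuous _ _ _
   (fun z => F a - \int[leb]_(x in `[a, z]) r x)).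
  by move=> z /set_mem; exact: FE.
apply: within_continuousB; first by move=> ?; exact: cvg_cst.
exact: parameterized_integral_continuous.
Qed.

Let g (z : R) : R := (Psi z)^-1 * expR (- F z).

Let g_within (a : R) : 0 < a -> a <= 1 -> {within `[a, 1], continuous g}.
Proof.
move=> a0 a1 x; apply: cvgM; last exact: within_continuous_expRN (F_within a0 a1) x.
have maxE (z : R) : 0 < z -> Num.max z 0 = z by move=> z0; apply/max_idPl/ltW.
apply: (@continuous_in_subspaceT _ _ `[a, 1] (fun z => (Psi z)^-1)) => z.
rewrite inE/= in_itv/= => /andP[az _].
have z0 : 0 < z by exact: lt_le_trans az.
have h : (Psi (Num.max y 0))^-1 @[y --> z] --> (Psi z)^-1.
  rewrite -[in X in _ --> X](maxE _ z0).
  by apply: cvgV; [rewrite maxE// gt_eqF// Psi_gt0|exact: Psi_continuous].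
apply: cvg_trans h; apply: near_eq_cvg; near=> y; rewrite maxE//.
near: y; exact: lt_nbhsr.
Unshelve. all: by end_near. Qed.

(** [occupation t] is the expectation of the integral of [exp (- X_s)] over
    [[0, t]], for the process started from [0]. *)
Definition occupation (t : R) : R := \int[leb]_(s in `[0, t]) expR (- J s 1).

Let eJ_within (a b : R) : 0 <= a ->
  {within `[a, b], continuous (fun s => expR (- J s 1))}.
Proof.
move=> a0; apply: within_continuous_expRN.
exact: (immigration_exponent_within_continuous vflow Phi_continuous ltr01 a0).
Qed.

Let occupationE (t : R) : 0 <= t ->
  (\int[leb]_(z in `[v t 1, 1%R]) (g z)%:E)%E = (occupation t)%:E.
Proof.
move=> t0; rewrite (flow_substitution vflow Psi_continuous Psi0 Psi_ratio Psi_gt0 ltr01 t0).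
  rewrite /occupation /Rintegral fineK.
    apply: eq_integral => s; rewrite inE/= in_itv/= => /andP[s0 _].
    by rewrite /g F_flow// mulrAC mulVf ?mul1r// gt_eqF// Psi_gt0// vgt0.
  apply: integrable_fin_num => //; apply: continuous_integrable_itv.
  exact: eJ_within.
by apply: g_within; [exact: vgt0|exact: vle1].
Qed.

Lemma occupation_bounds (a b : R) : 0 <= a -> a <= b ->
  (b - a) * expR (- J b 1) <= occupation b - occupation a <= (b - a) * expR (- J a 1).
Proof.
move=> a0 ab.
have ii : leb.-integrable `[0, b] (EFin \o (fun s => expR (- J s 1))).
  by apply: continuous_integrable_itv; exact: eJ_within.
have iab : leb.-integrable `]a, b] (EFin \o (fun s => expR (- J s 1))).
  by apply: integrableS ii => //; apply: subset_itvr; rewrite bnd_simp.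
rewrite /occupation (Rintegral_itvB ii) ?bnd_simp//.
have ic (c : R) : leb.-integrable `]a, b] (EFin \o (fun=> c)).
  have h : leb.-integrable `[a, b] (EFin \o (fun=> c)).
    apply: continuous_integrable_itv; apply: continuous_within.
    exact: cst_continuous.
  by apply: integrableS h => //; apply: subset_itvr; rewrite bnd_simp.
have cE (c : R) : \int[leb]_(s in `]a, b]) c = (b - a) * c.
  rewrite Rintegral_cst//= lebesgue_measure_itv/= lte_fin; case: ltP => ab'.
    by rewrite -EFinB/= mulrC.
  have -> : b = a by apply/eqP; rewrite eq_le ab ab'.
  by rewrite subrr/= mul0r mulr0.
have Jle (s t : R) : 0 <= s -> s <= t -> expR (- J t 1) <= expR (- J s 1).
  move=> s0 st; rewrite ler_expR lerN2.
  exact: (immigration_exponent_nondecreasing vflow Phi_continuous ltr01 Phi_ge0).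
have mab : measurable (`]a, b]%classic : set (measurableTypeR R)).
  exact: measurable_itv.
apply/andP; split.
  rewrite -[leLHS]cE; apply: (le_Rintegral mab (ic _) iab) => s /=.
  rewrite in_itv/= => /andP[a_s sb].
  by apply: Jle => //; rewrite (le_trans a0)// ltW.
rewrite -[leRHS]cE; apply: (le_Rintegral mab iab (ic _)) => s /=.
rewrite in_itv/= => /andP[a_s sb].
by apply: Jle => //; exact: ltW.
Qed.

(** The substitution [z = v t 1] maps the integral over [[v n 1, 1]] to
    [occupation n], because [F (v t 1) = J t 1] by the same substitution. *)
Lemma occupation_cvg :
  (occupation n%:R)%:E @[n --> \oo] -->
  (\int[leb]_(z in `]0%R, 1%R[)
    ((Psi z)^-1 * expR (- (\int[leb]_(x in `[z, 1%R]) (Phi x / Psi x))%R))%:E)%E.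
Proof.
pose A (n : nat) : set (measurableTypeR R) := `[v n%:R 1, 1]%classic.
have UA : \bigcup_n A n = `]0, 1]%classic.
  apply/seteqP; split=> z /=.
    move=> [n _]; rewrite /A /= !in_itv/= => /andP[vz ->]; rewrite andbT.
    by apply: lt_le_trans vz; exact: vgt0.
  rewrite in_itv/= => /andP[z0 z1].
  have [T T0 Tz] := flow_small vflow Psi0 Psi_ratio Psi_gt0 ltr01 z0.
  exists (Num.bound T) => //; rewrite /A /= in_itv/= z1 andbT.
  apply: le_trans (ltW Tz); apply: vdecr => //.
  by rewrite ltW// archi_boundP.
have mA n : measurable (A n) by exact: measurable_itv.
have mgA n : measurable_fun (A n) (fun z : measurableTypeR R => (g z)%:E).
  apply/measurable_EFinP; apply: subspace_continuous_measurable_fun; first exact: mA.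
  exact: (g_within (vgt0 (ler0n R n)) (vle1 (ler0n R n))).
have mg : measurable_fun (`]0, 1]%classic : set (measurableTypeR R))
    (fun z : measurableTypeR R => (g z)%:E).
  by rewrite -UA; exact/measurable_fun_bigcup.
rewrite -[X in _ --> X]/(\int[leb]_(z in `]0%R, 1%R[) (g z)%:E)%E.
rewrite integral_itv_bndo_bndc; last first.
  have m1 : measurable (`]0, 1]%classic : set (measurableTypeR R)).
    exact: measurable_itv.
  by apply: (measurable_funS m1 _ mg); apply: subset_itvl; rewrite bnd_simp.
rewrite -UA.
rewrite (_ : (fun n => _) = (fun n => \int[leb]_(z in A n) (g z)%:E)%E).
  apply: ge0_nondecreasing_set_cvg_integral => //.
    move=> m n mn; rewrite /A subsetEset; apply: subset_itvr; rewrite bnd_simp.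
    by apply: vdecr => //; rewrite ler_nat.
  move=> n z; rewrite /A /= in_itv/= => /andP[vz _]; rewrite lee_fin.
  rewrite mulr_ge0 ?expR_ge0// invr_ge0 ltW// Psi_gt0//.
  by apply: lt_le_trans vz; exact: vgt0.
by apply/funext => n; rewrite occupationE.
Qed.

End Potential.

(** * Killed sequences *)

Section BoundedVariables.
Context {d : measure_display} {T : measurableType d} {R : realType}.
Variable P : probability T R.
Implicit Types (f : T -> R) (A B : set T).

Definition bounded_measurable f :=
  measurable_fun setT f /\ exists M : R, forall w, `|f w| <= M.

Lemma bounded_integrable f A : bounded_measurable f -> measurable A ->
  P.-integrable A (EFin \o f).
Proof.
move=> [mf [M fM]] mA.
apply: (@integrable_dominated _ _ _ P A f (fun=> M)) => //.
  exact: measurable_funTS.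
exact: finite_measure_integrable_cst.
Qed.

Lemma bounded_measurableD f g : bounded_measurable f -> bounded_measurable g ->
  bounded_measurable (fun w => f w + g w).
Proof.
move=> [mf [M fM]] [mg [N gN]]; split; first exact: measurable_funD.
by exists (M + N) => w; rewrite (le_trans (ler_normD _ _))// lerD.
Qed.

Lemma bounded_measurableZ (k : R) f : bounded_measurable f ->
  bounded_measurable (fun w => k * f w).
Proof.
move=> [mf [M fM]]; split; first exact: measurable_funM.
by exists (`|k| * M) => w; rewrite normrM ler_wpM2l.
Qed.

Lemma bounded_measurable_sum (f : nat -> T -> R) n :
  (forall i, bounded_measurable (f i)) ->
  bounded_measurable (fun w => \sum_(i < n) f i w).
Proof.
move=> bf; elim: n => [|n IH].
  split; first by under eq_fun do rewrite big_ord0; exact: measurable_cst.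
  by exists 0 => w; rewrite big_ord0 normr0.
by under eq_fun do rewrite big_ord_recr/=; exact: bounded_measurableD.
Qed.

Lemma Rintegral_sum (f : nat -> T -> R) n A : measurable A ->
  (forall i, bounded_measurable (f i)) ->
  \int[P]_(w in A) (\sum_(i < n) f i w) = \sum_(i < n) \int[P]_(w in A) f i w.
Proof.
move=> mA bf; elim: n => [|n IH].
  rewrite big_ord0; under eq_Rintegral do rewrite big_ord0.
  by rewrite Rintegral_cst// mul0r.
rewrite big_ord_recr/= -IH -RintegralD//.
- by apply: eq_Rintegral => w _; rewrite big_ord_recr.
- by apply: bounded_integrable => //; exact: bounded_measurable_sum.
- exact: bounded_integrable.
Qed.

Lemma Rintegral_split f A B : bounded_measurable f -> measurable A -> measurable B ->
  \int[P]_(w in A) f w =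
  \int[P]_(w in A `&` B) f w + \int[P]_(w in A `\` B) f w.
Proof.
move=> bf mA mB; rewrite -{1}(setUIDK A B) Rintegral_setU//.
- exact: measurableI.
- exact: measurableD.
- by rewrite setUIDK; exact: bounded_integrable.
- by apply/disj_setPS => w [[_ wB] [_ nB]].
Qed.

Lemma Rintegral_le_cst f A (M : R) : bounded_measurable f -> measurable A ->
  (forall w, A w -> f w <= M) -> \int[P]_(w in A) f w <= M * fine (P A).
Proof.
move=> bf mA fM; rewrite -Rintegral_cst//; apply: le_Rintegral => //.
  exact: bounded_integrable.
exact: finite_measure_integrable_cst.
Qed.

Lemma Rintegral_ge_cst f A (M : R) : bounded_measurable f -> measurable A ->
  (forall w, A w -> M <= f w) -> M * fine (P A) <= \int[P]_(w in A) f w.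
Proof.
move=> bf mA fM; rewrite -Rintegral_cst//; apply: le_Rintegral => //.
  exact: finite_measure_integrable_cst.
exact: bounded_integrable.
Qed.

Lemma fine_probability_split A B : measurable A -> measurable B ->
  fine (P A) = fine (P (A `&` B)) + fine (P (A `\` B)).
Proof.
move=> mA mB; rewrite -fineD ?fin_num_measure//; [|exact: measurableI|exact: measurableD].
rewrite -measureU//; [|exact: measurableI|exact: measurableD|].
  by rewrite setUIDK.
by rewrite setDE setIACA setICr setI0.
Qed.

End BoundedVariables.

(** A sequence killed at the first index outside of the events [C i]. *)
Section Killing.
Context {d : measure_display} {T : measurableType d} {R : realType}.
Variable P : probability T R.
Variable C : nat -> set T.
Hypothesis mC : forall n, measurable (C n).

Definition survival n : set T := \bigcap_(i in `I_n) C i.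

Lemma survival0 : survival 0 = setT.
Proof. by apply/seteqP; split => // w _ i. Qed.

Lemma survivalS n : survival n.+1 = survival n `&` C n.
Proof.
apply/seteqP; split => [w h|w [h1 h2] i /=].
  by split; [move=> i /= ?; apply: h; exact: ltnW|apply: h => /=].
by rewrite ltnS leq_eqVlt => /predU1P[->//|]; exact: h1.
Qed.

Lemma measurable_survival n : measurable (survival n).
Proof.
by elim: n => [|n IH]; rewrite ?survival0 ?survivalS//; exact: measurableI.
Qed.

Let mS := measurable_survival.

(** The variables [f n] are indexed by time, so that potentials truncated at
    a fixed horizon are allowed. The supermartingale property is asked only
    on the survival events. *)
Lemma maximal_inequality (N : nat) (f : nat -> T -> R) (eta : R) :
  (forall n, bounded_measurable (f n)) -> (forall n w, 0 <= f n w) ->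
  (forall n w, (n < N)%N -> ~ C n w -> eta <= f n w) ->
  (forall n, (n < N)%N ->
    \int[P]_(w in survival n.+1) f n.+1 w <= \int[P]_(w in survival n.+1) f n w) ->
  eta * (1 - fine (P (survival N))) <= \int[P]_w f 0%N w.
Proof.
move=> bf f0 feta step.
suff : forall n, (n <= N)%N ->
    \int[P]_(w in survival n) f n w + eta * (1 - fine (P (survival n))) <=
    \int[P]_w f 0%N w.
  move=> /(_ N (leqnn N)); apply: le_trans; rewrite lerDr.
  by apply: Rintegral_ge0 => w _; exact: f0.
elim=> [_|n IH nN].
  by rewrite survival0 probability_setT/= subrr mulr0 addr0.
apply: le_trans (IH (ltnW nN)).
rewrite (Rintegral_split P (bf n) (mS n) (mC n)).
rewrite (fine_probability_split P (mS n) (mC n)) -survivalS.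
have := step _ nN.
have : eta * fine (P (survival n `\` C n)) <= \int[P]_(w in survival n `\` C n) f n w.
  apply: Rintegral_ge_cst => //; first exact: measurableD.
  by move=> w [_ nC]; exact: feta.
lra.
Qed.

(** Before killing, [h] increases on average by [c e] at each step, while it
    stays in [[0, 1]]. *)
Lemma lyapunov_bound (N : nat) (h e : nat -> T -> R) (c : R) :
  (forall n, bounded_measurable (h n)) -> (forall n w, 0 <= h n w <= 1) ->
  (forall n, \int[P]_(w in survival n.+1) h n w +
     c * \int[P]_(w in survival n.+1) e n w <= \int[P]_(w in survival n.+1) h n.+1 w) ->
  c * \sum_(n < N) \int[P]_(w in survival n.+1) e n w <= 1.
Proof.
move=> bh h01 step.
suff : forall n, c * (\sum_(n < n) \int[P]_(w in survival n.+1) e n w) +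
    \int[P]_w h 0%N w <=
    \int[P]_(w in survival n) h n w + (1 - fine (P (survival n))).
  move=> /(_ N).
  have : 0 <= \int[P]_w h 0%N w.
    by apply: Rintegral_ge0 => w _; have /andP[] := h01 0%N w.
  have : \int[P]_(w in survival N) h N w <= 1 * fine (P (survival N)).
    by apply: Rintegral_le_cst => // w _; have /andP[] := h01 N w.
  lra.
elim=> [|n IH].
  by rewrite survival0 probability_setT/= subrr addr0 big_ord0 mulr0 add0r.
rewrite big_ord_recr/= mulrDr.
move: IH; rewrite (Rintegral_split P (bh n) (mS n) (mC n)).
rewrite (fine_probability_split P (mS n) (mC n)) -survivalS.
have := step n.
have : \int[P]_(w in survival n `\` C n) h n w <= 1 * fine (P (survival n `\` C n)).
  apply: Rintegral_le_cst => //; first exact: measurableD.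
  by move=> w _; have /andP[] := h01 n w.
lra.
Qed.

(** First-passage decomposition of a potential: what is not collected before
    killing is at most [M] times the probability of being killed. *)
Lemma first_passage_bound (N : nat) (f e : nat -> T -> R) (M : R) :
  (forall n, bounded_measurable (f n)) -> (forall n w, f n w <= M) ->
  (forall w, f N w = 0) ->
  (forall n, (n < N)%N -> \int[P]_(w in survival n.+1) f n w <=
     \int[P]_(w in survival n.+1) e n w + \int[P]_(w in survival n.+1) f n.+1 w) ->
  \int[P]_w f 0%N w <= \sum_(n < N) \int[P]_(w in survival n.+1) e n w +
    M * (1 - fine (P (survival N))).
Proof.
move=> bf fM fN step.
suff : forall n, (n <= N)%N -> \int[P]_w f 0%N w <=
    \sum_(n < n) \int[P]_(w in survival n.+1) e n w +
    \int[P]_(w in survival n) f n w + M * (1 - fine (P (survival n))).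
  move=> /(_ N (leqnn N)); rewrite (_ : \int[P]_(w in survival N) f N w = 0) ?addr0//.
  under eq_Rintegral do rewrite fN.
  by rewrite Rintegral_cst// mul0r.
elim=> [_|n IH nN].
  by rewrite survival0 probability_setT/= subrr mulr0 addr0 big_ord0 add0r.
apply: le_trans (IH (ltnW nN)) _.
rewrite big_ord_recr/=.
rewrite (Rintegral_split P (bf n) (mS n) (mC n)).
rewrite (fine_probability_split P (mS n) (mC n)) -survivalS.
have := step _ nN.
have : \int[P]_(w in survival n `\` C n) f n w <= M * fine (P (survival n `\` C n)).
  by apply: Rintegral_le_cst => //; exact: measurableD.
lra.
Qed.

End Killing.

(** * The Markov property on exponential functions *)

Section Disintegration.
Import HBNNSimple.
Local Open Scope ereal_scope.
Context {d d' : measure_display} {T : measurableType d} {Y : measurableType d'}.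
Context {R : realType}.
Variables (m : {measure set T -> \bar R}) (k : T -> {measure set T -> \bar R}).
Variables (A : set T) (phi psi : T -> Y).
Hypothesis mA : measurable A.
Hypothesis mphi : measurable_fun setT phi.
Hypothesis mpsi : measurable_fun setT psi.
Hypothesis mk : forall B, measurable B ->
  measurable_fun A (fun x => k x (psi @^-1` B)).
Hypothesis mE : forall B, measurable B ->
  m (A `&` phi @^-1` B) = \int[m]_(x in A) k x (psi @^-1` B).

Let mphiB B : measurable B -> measurable (phi @^-1` B).
Proof. by move=> mB; rewrite -[X in measurable X]setTI; exact: mphi. Qed.

Let mpsiB B : measurable B -> measurable (psi @^-1` B).
Proof. by move=> mB; rewrite -[X in measurable X]setTI; exact: mpsi. Qed.

Let kE (h : {nnsfun Y >-> R}) (x : T) :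
  \int[k x]_w (h (psi w))%:E =
  \sum_(r \in range h) r%:E * k x (psi @^-1` (h @^-1` [set r])).
Proof.
under eq_integral do rewrite fimfunE -fsumEFin//.
rewrite ge0_integral_fsum//; last 2 first.
  - move=> r; apply/measurable_EFinP; apply: measurable_funM => //.
    by apply: measurableT_comp mpsi; exact: measurable_indic.
  - by move=> r w _; rewrite EFinM nnfun_muleindic_ge0.
apply: eq_fsbigr => r _.
have -> : (fun w => (r * \1_(h @^-1` [set r]) (psi w))%:E) =
    (fun w => (r * \1_(psi @^-1` (h @^-1` [set r])) w)%:E) by [].
rewrite (@integralZl_indic _ _ _ (k x) setT measurableT
  (fun r => psi @^-1` (h @^-1` [set r])))//; last 2 first.
- by move=> r0; rewrite preimage_nnfun0.
- exact: mpsiB.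
by rewrite integral_indic ?setIT//; exact: mpsiB.
Qed.

Let mkint (h : {nnsfun Y >-> R}) :
  measurable_fun A (fun x => \int[k x]_w (h (psi w))%:E).
Proof.
under eq_fun do rewrite kE.
apply: emeasurable_fsum => // r.
by apply: measurable_funeM; exact: mk.
Qed.

Let nnsfun_case (h : {nnsfun Y >-> R}) :
  \int[m]_(x in A) (h (phi x))%:E = \int[m]_(x in A) \int[k x]_w (h (psi w))%:E.
Proof.
under [in RHS]eq_integral do rewrite kE.
rewrite /= ge0_integral_fsum//; last 2 first.
  - by move=> r; apply: measurable_funeM; exact: mk.
  - move=> r x _; have [r0|r0] := leP 0%R r; first by rewrite mule_ge0.
    have -> : h @^-1` [set r] = set0 by exact: preimage_nnfun0.
    by rewrite preimage_set0 measure0 mule0.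
under [in LHS]eq_integral do rewrite fimfunE -fsumEFin//.
rewrite ge0_integral_fsum//; last 2 first.
  - move=> r; apply/measurable_EFinP; apply: measurable_funTS.
    apply: measurable_funM => //.
    by apply: measurableT_comp mphi; exact: measurable_indic.
  - by move=> r w _; rewrite EFinM nnfun_muleindic_ge0.
apply: eq_fsbigr => r _.
have -> : (fun w => (r * \1_(h @^-1` [set r]) (phi w))%:E) =
    (fun w => (r * \1_(phi @^-1` (h @^-1` [set r])) w)%:E) by [].
rewrite (@integralZl_indic _ _ _ m A mA
  (fun r => phi @^-1` (h @^-1` [set r])))//; last 2 first.
- by move=> r0; rewrite preimage_nnfun0.
- exact: mphiB.
rewrite integral_indic//; last exact: mphiB.
rewrite setIC mE//.
have [r0|r0] := leP 0%R r.
  by rewrite ge0_integralZl//; exact: mk.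
have -> : h @^-1` [set r] = set0 by exact: preimage_nnfun0.
by rewrite preimage_set0 !integral0_eq ?mule0// => x _; rewrite measure0 ?mule0.
Qed.

(** Extension of an identity between measures of events to nonnegative
    functions, through simple functions. Two observables [phi] and [psi]
    appear because the transition function of a process is the law of its
    value at time [t], rather than a kernel on the state space. *)
Lemma integral_disintegration (f : Y -> \bar R) : (forall y, 0 <= f y) ->
  measurable_fun setT f ->
  \int[m]_(x in A) f (phi x) = \int[m]_(x in A) \int[k x]_w f (psi w).
Proof.
move=> f0 mf.
pose f_ := nnsfun_approx measurableT mf.
have f_cvg y : (f_ n y)%:E @[n --> \oo] --> f y by exact: cvg_nnsfun_approx.
have f_nd y a b : (a <= b)%N -> (f_ a y)%:E <= (f_ b y)%:E.
  by move=> ab; rewrite lee_fin; exact/lefP/nd_nnsfun_approx.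
have mf_ n : measurable_fun setT (fun y => (f_ n y)%:E) by exact/measurable_EFinP.
have kint x : \int[k x]_w f (psi w) = lim (\int[k x]_w (f_ n (psi w))%:E @[n --> \oo]).
  rewrite -monotone_convergence//.
  - by apply: eq_integral => w _; apply/esym/cvg_lim => //; exact: f_cvg.
  - by move=> n; exact: (measurableT_comp (mf_ _) mpsi).
  - by move=> n w _; rewrite lee_fin.
  - by move=> w _ a b; exact: f_nd.
transitivity (\int[m]_(x in A) lim ((f_ n (phi x))%:E @[n --> \oo])).
  by apply: eq_integral => x _; apply/esym/cvg_lim => //; exact: f_cvg.
rewrite monotone_convergence//; last 3 first.
- by move=> n; apply: measurable_funTS; exact: (measurableT_comp (mf_ _) mphi).
- by move=> n w _; rewrite lee_fin.
- by move=> w _ a b; exact: f_nd.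
under eq_fun do rewrite nnsfun_case.
rewrite -monotone_convergence//; last 2 first.
- by move=> n x _; apply: integral_ge0 => w _; rewrite lee_fin.
- move=> x _ a b ab; apply: ge0_le_integral => //.
  + by move=> w _; rewrite lee_fin.
  + by exact: (measurableT_comp (mf_ _) mpsi).
  + by exact: (measurableT_comp (mf_ _) mpsi).
  + by move=> w _; exact: f_nd.
by apply: eq_integral => x _; rewrite kint.
Qed.

End Disintegration.

Section ExponentialFunctions.
Context {R : realType}.

(** [y |-> exp (- q y)], extended by [0] at [+oo]. *)
Definition eexp (q : R) (y : \bar R) : R :=
  if y is r%:E then expR (- (q * r)) else 0.

Lemma eexp_ge0 q y : 0 <= eexp q y.
Proof. by case: y => //= r; exact: expR_ge0. Qed.

Lemma eexp_le1 (q : R) y : 0 <= q -> (0 <= y)%E -> eexp q y <= 1.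
Proof.
by case: y => //= r q0; rewrite lee_fin => r0; apply: expRN_le1; rewrite mulr_ge0.
Qed.

Lemma expeR_eexp (q : R) y : 0 < q -> (0 <= y)%E ->
  expeR (- (q%:E * y)) = (eexp q y)%:E.
Proof. by move=> q0; case: y => //= _; rewrite gt0_muley. Qed.

Lemma measurable_eexp q : measurable_fun setT (eexp q).
Proof.
have mfin : measurable [set y : \bar R | y \is a fin_num].
  have := @emeasurable_fin_num _ _ R setT (@id (\bar R)) measurableT (@measurable_id _ _ _).
  by rewrite setTI.
rewrite (_ : eexp q = fun y => \1_[set y : \bar R | y \is a fin_num] y *
    expR (- (q * fine y))).
  apply: measurable_funM; first exact: measurable_indic.
  apply: measurableT_comp => //; apply: measurable_funN.
  by apply: measurable_funM => //; exact: fine_measurable.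
apply/funext => -[r||]; rewrite indicE /=.
- by rewrite mem_set//= mul1r.
- by rewrite memNset//= mul0r.
- by rewrite memNset//= mul0r.
Qed.

End ExponentialFunctions.

Section MarkovProcess.
Context {R : realType} {d : measure_display} {Omega : measurableType d}.
Variables (X : R -> Omega -> \bar R) (P : \bar R -> probability Omega R).
Hypothesis XP : markov_process X P.

Lemma measurable_state_space : measurable (@state_space R).
Proof.
rewrite (_ : state_space = [set` `[0%E, +oo%E]]); first exact: emeasurable_itv.
by apply/seteqP; split => y /=; rewrite /state_space/= in_itv/= ?leey ?andbT.
Qed.

Lemma natural_filtration_measurable (s : R) A : natural_filtration X s A -> measurable A.
Proof.
apply: smallest_sub; first exact: sigma_algebra_measurable.
move=> _ [r [B [/andP[r0 _] mB ->]]].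
by rewrite -[X in measurable X]setTI; exact: (markov_measurable XP r0).
Qed.

Lemma natural_filtrationT s : natural_filtration X s setT.
Proof. exact: (@measurableT _ (g_sigma_algebraType _)). Qed.

Lemma natural_filtrationI s A B : natural_filtration X s A ->
  natural_filtration X s B -> natural_filtration X s (A `&` B).
Proof. exact: (@measurableI _ (g_sigma_algebraType _)). Qed.

Lemma natural_filtration_le (s t : R) A : s <= t -> natural_filtration X s A ->
  natural_filtration X t A.
Proof.
move=> st; apply: sub_sigma_algebra2 => _ [r [B [/andP[r0 rs] mB ->]]].
by exists r, B; split => //; rewrite r0 (le_trans rs).
Qed.

Lemma natural_filtration_preimage (s : R) (B : set (\bar R)) : 0 <= s -> measurable B ->
  natural_filtration X s (X s @^-1` B).
Proof.
by move=> s0 mB; apply: sub_sigma_algebra; exists s, B; split => //; rewrite s0 lexx.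
Qed.

Lemma natural_filtration_survival (t : nat -> R) (B : set (\bar R)) n :
  (forall i, 0 <= t i) -> {homo t : i j / (i <= j)%N >-> i <= j} -> measurable B ->
  natural_filtration X (t n) (survival (fun i => X (t i) @^-1` B) n.+1).
Proof.
move=> t0 tnd mB; elim: n => [|n IH]; rewrite survivalS.
  apply: natural_filtrationI; last exact: natural_filtration_preimage.
  by rewrite survival0; exact: natural_filtrationT.
apply: natural_filtrationI; last exact: natural_filtration_preimage.
by apply: natural_filtration_le IH; exact: tnd.
Qed.

Lemma markov_integral (y : \bar R) (s r : R) (A : set Omega) (f : \bar R -> \bar R) :
  state_space y -> 0 <= s -> 0 <= r -> natural_filtration X s A ->
  (forall z, 0 <= f z)%E -> measurable_fun setT f ->
  (\int[P y]_(w in A) f (X (s + r) w) =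
   \int[P y]_(w in A) \int[P (X s w)]_w' f (X r w'))%E.
Proof.
move=> y0 s0 r0 FA f0 mf.
have mA := natural_filtration_measurable FA.
apply: (@integral_disintegration _ _ _ _ _ (P y) (fun w => P (X s w)) A
  (X (s + r)) (X r)) => //.
- exact: (markov_measurable XP (addr_ge0 s0 r0)).
- exact: (markov_measurable XP r0).
- move=> B mB.
  apply: (measurable_comp measurable_state_space _ (markov_kernel XP r0 mB)).
    by move=> _ [w _ <-]; exact: (markov_state XP w s0).
  exact/measurable_funTS/(markov_measurable XP s0).
- by move=> B mB; exact: (markov_property XP y0 s0 r0 FA mB).
Qed.

End MarkovProcess.

Section ExponentialMoments.
Context {R : realType} {d : measure_display} {Omega : measurableType d}.
Variables (X : R -> Omega -> \bar R) (P : \bar R -> probability Omega R).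
Variables (Phi : R -> R) (v : R -> R -> R).
Hypothesis XP : markov_process X P.
Hypothesis absorbed : absorbed_at_infinity X.
Local Notation J := (immigration_exponent Phi v).
Hypothesis laplace : forall q x t : R, 0 < q -> 0 <= x -> 0 <= t ->
  (\int[P x%:E]_w expeR (- (q%:E * X t w)) = (expR (- (x * v t q) - J t q))%:E)%E.
Hypothesis v_ge0 : forall q t : R, 0 < q -> 0 <= t -> 0 <= v t q.

(** [pexp t q y] is the expectation of [exp (- q X_t)] under [P y]. *)
Definition pexp (t q : R) (y : \bar R) : R := expR (- J t q) * eexp (v t q) y.

Lemma pexp_ge0 t q y : 0 <= pexp t q y.
Proof. by rewrite mulr_ge0 ?expR_ge0 ?eexp_ge0. Qed.

Let Xge0 (t : R) w : 0 <= t -> (0 <= X t w)%E.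
Proof. exact: (markov_state XP). Qed.

Lemma bounded_measurable_eexp (t q : R) : 0 <= t -> 0 <= q ->
  bounded_measurable (fun w => eexp q (X t w)).
Proof.
move=> t0 q0; split.
  exact: measurableT_comp (measurable_eexp q) (markov_measurable XP t0).
by exists 1 => w; rewrite ger0_norm ?eexp_ge0// eexp_le1// Xge0.
Qed.

Lemma bounded_measurable_pexp (t s q : R) : 0 <= t -> 0 <= s -> 0 < q ->
  bounded_measurable (fun w => pexp t q (X s w)).
Proof.
move=> t0 s0 q0; apply: bounded_measurableZ.
by apply: bounded_measurable_eexp => //; exact: v_ge0.
Qed.

Let expectation_eexp_ereal (t q : R) (y : \bar R) : 0 < q -> 0 <= t -> (0 <= y)%E ->
  (\int[P y]_w (eexp q (X t w))%:E = (pexp t q y)%:E)%E.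
Proof.
move=> q0 t0; case: y => [x| |]//.
  rewrite lee_fin => x0.
  under eq_integral do rewrite -expeR_eexp ?Xge0//.
  by rewrite laplace// /pexp /= -expRD addrC mulrC.
move=> _; rewrite /pexp/= mulr0.
have m0 : measurable (X 0 @^-1` [set +oo%E]).
  by rewrite -[X in measurable X]setTI; apply: (markov_measurable XP (lexx 0)).
have P0 : P +oo%E (~` (X 0 @^-1` [set +oo%E])) = 0%E.
  have P1 : P +oo%E (X 0 @^-1` [set +oo%E]) = 1%E.
    by apply: (markov_start XP); rewrite /state_space/= leey.
  by rewrite probability_setC// P1 subee.
rewrite (negligible_integral (measurableC m0) _ _ P0)//.
  apply: integral0_eq => w [_ /contrapT/= X0].
  by rewrite (absorbed (lexx 0) t0 X0).
have ii := bounded_integrable (P +oo%E) (bounded_measurable_eexp t0 (ltW q0)) measurableT.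
exact: ii.
Qed.

Lemma expectation_eexp (t q : R) (y : \bar R) : 0 < q -> 0 <= t -> (0 <= y)%E ->
  \int[P y]_w eexp q (X t w) = pexp t q y.
Proof. by move=> q0 t0 y0; rewrite /Rintegral expectation_eexp_ereal. Qed.

Let markov_eexp (s r q : R) (y : \bar R) (A : set Omega) : 0 < q -> 0 <= s -> 0 <= r ->
  (0 <= y)%E -> natural_filtration X s A ->
  \int[P y]_(w in A) eexp q (X (s + r) w) = \int[P y]_(w in A) pexp r q (X s w).
Proof.
move=> q0 s0 r0 y0 FA; rewrite /Rintegral.
rewrite (@markov_integral _ _ _ X P XP y s r A (EFin \o eexp q))//.
- congr fine; apply: eq_integral => w _.
  by rewrite expectation_eexp_ereal// Xge0.
- by move=> z; rewrite lee_fin eexp_ge0.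
- exact/measurable_EFinP/measurable_eexp.
Qed.

(** The semigroup property of the flow, in the form of the Chapman-Kolmogorov
    equation for exponentials. *)
Lemma pexpD (s t q : R) (y : \bar R) : 0 < q -> 0 < v t q -> 0 <= s -> 0 <= t ->
  (0 <= y)%E -> pexp (s + t) q y = expR (- J t q) * pexp s (v t q) y.
Proof.
move=> q0 vq0 s0 t0 y0.
rewrite -expectation_eexp ?addr_ge0// markov_eexp//; last exact: natural_filtrationT.
rewrite -expectation_eexp //.
rewrite -RintegralZl//.
by apply: bounded_integrable => //; apply: bounded_measurable_eexp => //; exact: ltW.
Qed.

Lemma markov_pexp (s r t q : R) (y : \bar R) (A : set Omega) :
  0 < q -> 0 < v t q -> 0 <= s -> 0 <= r -> 0 <= t -> (0 <= y)%E -> natural_filtration X s A ->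
  \int[P y]_(w in A) pexp t q (X (s + r) w) =
  \int[P y]_(w in A) pexp (r + t) q (X s w).
Proof.
move=> q0 vq0 s0 r0 t0 y0 FA; have mA := natural_filtration_measurable XP FA.
rewrite RintegralZl//; last first.
  by apply: bounded_integrable mA; apply: bounded_measurable_eexp;
    [exact: addr_ge0|exact: ltW].
rewrite markov_eexp // -RintegralZl//; last first.
  by apply: bounded_integrable mA; apply: bounded_measurable_pexp => //.
by apply: eq_Rintegral => w _; rewrite pexpD// Xge0.
Qed.

Lemma expectation_pexp (s t q : R) (y : \bar R) :
  0 < q -> 0 < v t q -> 0 <= s -> 0 <= t -> (0 <= y)%E ->
  \int[P y]_w pexp t q (X s w) = pexp (s + t) q y.
Proof.
move=> q0 vq0 s0 t0 y0; rewrite pexpD// -expectation_eexp // -RintegralZl//.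
by apply: bounded_integrable => //; apply: bounded_measurable_eexp => //; exact: ltW.
Qed.

End ExponentialMoments.

(** * Transience *)

Section TransienceCriterion.
Context {R : realType} {d : measure_display} {Omega : measurableType d}.
Variables (X : R -> Omega -> \bar R) (Q : probability Omega R).
Hypothesis mX : forall t : R, 0 <= t -> measurable_fun setT (X t).
Hypothesis cX : cadlag_paths X.

Definition above (a : R) : set (\bar R) := [set y | (a%:E <= y)%E].

Lemma measurable_above a : measurable (above a).
Proof.
rewrite (_ : above a = [set` `[a%:E, +oo%E]]); first exact: emeasurable_itv.
by apply/seteqP; split => y /=; rewrite /above/= in_itv/= ?leey ?andbT.
Qed.

Let grid (m k n : nat) : R := m.+1%:R + n%:R * (2 ^+ k)^-1.

Lemma measurable_above_event a t : 0 <= t -> measurable (X t @^-1` above a).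
Proof.
move=> t0; rewrite -[X in measurable X]setTI; apply: mX => //.
exact: measurable_above.
Qed.

Let grid_ge0 m k n : 0 <= grid m k n.
Proof. by rewrite addr_ge0// mulr_ge0// invr_ge0 exprn_ge0. Qed.

Let S (a : R) (m k N : nat) := survival (fun n => X (grid m k n) @^-1` above a) N.

Let mS a m k N : measurable (S a m k N).
Proof. by apply: measurable_survival => n; exact: measurable_above_event. Qed.

Let W (a : R) (m j : nat) := ~` S a m j (j * 2 ^ j)%N.

Let WP a m j w : W a m j w <->
  exists2 n, (n < j * 2 ^ j)%N & (X (grid m j n) w < a%:E)%E.
Proof.
split.
  move=> nS; apply: contrapT => h; apply: nS => n /= nj.
  by rewrite /above/= leNgt; apply/negP => hn; apply: h; exists n.
by move=> [n nj h] /(_ n nj) /=; rewrite /above/= leNgt h.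
Qed.

Let W_nd a m : {homo W a m : i j / (i <= j)%N >-> (i <= j)%O}.
Proof.
apply: homo_leq => [A|A B C AB BC|j]; first exact: lexx.
  exact: le_trans AB BC.
apply/subsetPset => w /WP[n nj h]; apply/WP; exists (2 * n)%N.
  by rewrite expnS mulnCA ltn_pmul2l// (leq_trans nj)// leq_mul2r leqnSn orbT.
rewrite (_ : grid m j.+1 (2 * n) = grid m j n)//.
rewrite /grid natrM exprS; congr (_ + _); field.
by rewrite expf_neq0.
Qed.

(** By right-continuity, an entrance of the path below [a] is seen on a fine
    enough dyadic grid. *)
Let W_cover a m w (s : R) : m.+1%:R <= s -> (X s w < a%:E)%E ->
  exists j, W a m j w.
Proof.
move=> ms Xs; have s0 : 0 <= s by exact: le_trans ms.
have [cr _] := cX w.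
have := cr s s0 => /(_ [set y | (y < a%:E)%E]).
have nb : nbhs (X s w) [set y | (y < a%:E)%E].
  by apply: open_nbhs_nbhs; split => //; exact: open_ereal_lt_ereal.
move=> /(_ nb) [e /= e0 he].
pose c := s - m.+1%:R; have c0 : 0 <= c by rewrite subr_ge0.
(* the mesh is smaller than e, and the grid reaches beyond time s + 1 *)
pose j := maxn (Num.bound e^-1) (Num.bound (c + 2)).
exists j; apply/WP.
have p0 : 0 < 2 ^+ j :> R by rewrite exprn_gt0.
have je : (2 ^+ j)^-1 < e.
  rewrite invf_plt ?posrE//.
  by apply: upper_nthrootP; rewrite leq_maxl.
have jc : c + 2 < j%:R.
  apply: lt_le_trans (archi_boundP _) _; first by rewrite addr_ge0.
  by rewrite ler_nat leq_maxr.
have /andP[h1 h2] := truncn_itv (mulr_ge0 c0 (ltW p0)).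
set n := Num.trunc (c * 2 ^+ j) in h1 h2.
exists n.+1.
  rewrite -(ltr_nat R) natrM natrX -natr1.
  have : (c + 2) * 2 ^+ j < j%:R * 2 ^+ j by rewrite ltr_pM2r.
  have : 1 <= 2 ^+ j :> R by rewrite exprn_ege1// ler1n.
  lra.
have g1 : c < n.+1%:R * (2 ^+ j)^-1 by rewrite ltr_pdivlMr.
have g2 : n.+1%:R * (2 ^+ j)^-1 <= c + (2 ^+ j)^-1.
  by rewrite -natr1 mulrDl mul1r lerD2r ler_pdivrMr.
have gE : grid m j n.+1 = s + (n.+1%:R * (2 ^+ j)^-1 - c).
  by rewrite /grid /c; lra.
apply: he => /=; last by rewrite gE ltrDl subr_gt0.
rewrite gE opprD addrA subrr sub0r normrN ger0_norm; last by rewrite subr_ge0 ltW.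
lra.
Qed.

(** The grids [m + 1 + n / 2 ^ k] are nested in [k] and catch every entrance
    of the path in [[0, a)] after time [m + 1], so that the bound [beta m],
    uniform in [k] and [N], passes to the event that such an entrance occurs. *)
Lemma transience_criterion :
  (forall a : R, 0 <= a -> exists2 beta : nat -> R, beta m @[m --> \oo] --> 0 &
    forall m k N : nat,
      1 - fine (Q (survival (fun n =>
        X (m.+1%:R + n%:R * (2 ^+ k)^-1) @^-1` above a) N)) <= beta m) ->
  {ae Q, forall w, X t w @[t --> +oo%R] --> +oo%E}.
Proof.
move=> H.
pose U (a m : nat) := \bigcup_j W a%:R m j.
have mW a m j : measurable (W a m j) by exact: measurableC.
have mU a m : measurable (U a m) by apply: bigcup_measurable => j _; exact: mW.
have mI a : measurable (\bigcap_m U a m) by apply: bigcap_measurable => //; exists 0%N.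
have I0 a : Q (\bigcap_m U a m) = 0%E.
  have [beta beta0 hbeta] := H a%:R (ler0n R a).
  have Ub m : (Q (U a m) <= (beta m)%:E)%E.
    have cv := nondecreasing_cvg_mu (mu := Q) (fun j => mW a%:R m j) (mU a m) (W_nd a%:R m).
    rewrite -(cvg_lim _ cv)//; apply: lime_le; first by apply: cvgP cv.
    apply: nearW => j; have mSj := mS a%:R m j (j * 2 ^ j)%N.
    have -> : (Q \o W a%:R m) j = (1 - Q (S a%:R m j (j * 2 ^ j)))%E.
      exact: probability_setC.
    rewrite -(@fineK _ (Q (S _ _ _ _))) ?fin_num_measure//.
    by rewrite -EFinB lee_fin; exact: hbeta.
  apply/eqP; rewrite eq_le measure_ge0 andbT.
  have cvb : (beta m)%:E @[m --> \oo] --> 0%:E by apply: cvg_EFin => //; exact: nearW.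
  have <- : limn (fun m => (beta m)%:E) = 0%E by exact/cvg_lim.
  apply: lime_ge; first exact: cvgP cvb.
  apply: nearW => m; apply: le_trans (Ub m).
  by apply: le_measure; rewrite ?inE//; exact: bigcap_inf.
have nI a : Q.-negligible (\bigcap_m U a m).
  by exists (\bigcap_m U a m); split; [exact: mI|exact: I0|].
apply: negligibleS (negligible_bigcup nI).
move=> w /=; apply: contra_notP => nU.
apply/cvgeyPge => A; pose a := Num.bound `|A|.
have Aa : A <= a%:R.
  by rewrite (le_trans (ler_norm _))// ltW// archi_boundP.
have [m hm] : exists m, ~ U a m w.
  by apply/existsNP => h; apply: nU; exists a => // m _; exact: h.
near=> s.
have ms : m.+1%:R <= s by near: s; exact: nbhs_pinfty_ge.
rewrite (@le_trans _ _ a%:R%:E)// ?lee_fin// leNgt; apply/negP => Xs.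
by have [j Wj] := W_cover ms Xs; apply: hm; exists j.
Unshelve. all: by end_near. Qed.

End TransienceCriterion.

Section Transience.
Context {R : realType} {d : measure_display} {Omega : measurableType d}.
Variables (X : R -> Omega -> \bar R) (P : \bar R -> probability Omega R).
Variables (Phi : R -> R) (v : R -> R -> R).
Hypothesis XP : markov_process X P.
Hypothesis absorbed : absorbed_at_infinity X.
Hypothesis cX : cadlag_paths X.
Local Notation J := (immigration_exponent Phi v).
Local Notation pexp := (pexp Phi v).
Hypothesis laplace : forall q x t : R, 0 < q -> 0 <= x -> 0 <= t ->
  (\int[P x%:E]_w expeR (- (q%:E * X t w)) = (expR (- (x * v t q) - J t q))%:E)%E.
Hypothesis v_ge0 : forall q t : R, 0 < q -> 0 <= t -> 0 <= v t q.

Let mX (t : R) : 0 <= t -> measurable_fun setT (X t).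
Proof. exact: (markov_measurable XP). Qed.

Let Xge0 (t : R) w : 0 <= t -> (0 <= X t w)%E.
Proof. exact: (markov_state XP). Qed.

Let eexp_below (q a : R) (y : \bar R) : 0 <= q -> (0 <= y)%E -> ~ above a y ->
  expR (- (q * a)) <= eexp q y.
Proof.
rewrite /above/= => q0; case: y => [r| |]//=.
  rewrite !lee_fin => r0 /negP; rewrite -ltNge => ra.
  by rewrite ler_expR lerN2 ler_wpM2l// ltW.
by move=> _ []; rewrite leey.
Qed.

(** At a rest point [rho] of the flow, [exp (- rho X_t)] is a supermartingale
    whose expectation decays exponentially. *)
Lemma rest_point_transient (rho : R) : 0 < rho ->
  (forall t, 0 <= t -> v t rho = rho) -> 0 < Phi rho -> transient X P.
Proof.
move=> r0 vr Pr x x0.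
have JE (t : R) : 0 <= t -> J t rho = t * Phi rho.
  move=> t0; rewrite /immigration_exponent.
  rewrite (@eq_Rintegral _ _ _ _ _ (fun=> Phi rho)); last first.
    by move=> s; rewrite inE/= in_itv/= => /andP[s0 _]; rewrite vr.
  have m0t : measurable (`[0, t]%classic : set (measurableTypeR R)).
    exact: measurable_itv.
  rewrite Rintegral_cst//= lebesgue_measure_itv/= lte_fin.
  have := t0; rewrite le_eqVlt => /predU1P[<-|->].
    by rewrite ltxx/= mulr0 mul0r.
  by rewrite -EFinB/= subr0 mulrC.
apply: (transience_criterion mX cX) => a a0.
exists (fun m => expR (rho * a) * (expR (- Phi rho) ^+ m.+1 * expR (- (rho * x)))).
  rewrite -[X in _ --> X](mulr0 (expR (rho * a))); apply: cvgMr.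
  rewrite -[X in _ --> X](mul0r (expR (- (rho * x)))); apply: cvgMl.
  rewrite (cvg_shiftS (GRing.exp (expR (- Phi rho)))); apply: cvg_expr.
  by rewrite ger0_norm ?expR_ge0// expR_lt1 oppr_lt0.
move=> m k N.
set t := fun n : nat => (m.+1%:R + n%:R * (2 ^+ k)^-1 : R).
have d0 : 0 <= (2 ^+ k)^-1 :> R by rewrite invr_ge0 exprn_ge0.
have t0 n : 0 <= t n by rewrite addr_ge0// mulr_ge0.
have tS n : t n.+1 = t n + (2 ^+ k)^-1 by rewrite /t -(natr1 n) mulrDl mul1r addrA.
have tnd : {homo t : i j / (i <= j)%N >-> i <= j}.
  by move=> i j ij; rewrite lerD2l ler_wpM2r// ler_nat.
pose f (n : nat) w := pexp 0 rho (X (t n) w).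
have pE s y : 0 <= s -> pexp s rho y = expR (- (s * Phi rho)) * eexp rho y.
  by move=> s0; rewrite /(pexp _ _ _) JE// vr.
have p0E y : pexp 0 rho y = eexp rho y by rewrite pE// mul0r oppr0 expR0 mul1r.
have bf n : bounded_measurable (f n).
  by apply: (bounded_measurable_pexp Phi XP v_ge0).
have v0r : 0 < v 0 rho by rewrite vr.
have xE : (0 <= x%:E)%E by rewrite lee_fin.
have := @maximal_inequality _ _ _ (P x%:E) (fun n => X (t n) @^-1` above a)
  (fun n => measurable_above_event mX a (t0 n)) N f (expR (- (rho * a))) bf.
have -> : \int[P x%:E]_w f 0%N w = expR (- Phi rho) ^+ m.+1 * expR (- (rho * x)).
  rewrite /f (expectation_pexp XP absorbed laplace)// addr0.
  by rewrite pE// /t mul0r addr0 -expRM_natl mulrN.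
move=> h; rewrite -(@ler_pM2l _ (expR (- (rho * a)))) ?expR_gt0//.
rewrite [leRHS]mulrA -expRD addNr expR0 mul1r; apply: h.
- by move=> n w; exact: pexp_ge0.
- by move=> n w _ nC; rewrite /f p0E; apply: eexp_below => //; [exact: ltW|exact: Xge0].
move=> n nN.
have FS : natural_filtration X (t n) (survival (fun i => X (t i) @^-1` above a) n.+1).
  by apply: natural_filtration_survival => //; exact: measurable_above.
have mS := natural_filtration_measurable XP FS.
rewrite /f tS (markov_pexp XP absorbed laplace v_ge0)// addr0.
apply: le_Rintegral => //.
- by apply: bounded_integrable => //; exact: (bounded_measurable_pexp Phi XP v_ge0).
- exact: (bounded_integrable _ (bf n) mS).
move=> w _; rewrite p0E pE// ler_piMl ?eexp_ge0//.
by apply: expRN_le1; rewrite mulr_ge0// ltW.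
Qed.

(** If the potential of [exp (- X)] is finite, its Riemann sums along the
    dyadic grids are supermartingales up to a truncation, bounded below on
    [[0, a)] uniformly in the mesh. *)
Lemma occupation_transient (occ : R -> R) (K : R) :
  (forall t, 0 <= t -> 0 < v t 1) -> (forall t, 0 <= t -> v t 1 <= 1) ->
  (forall s t, 0 <= s -> s <= t -> J s 1 <= J t 1) ->
  (forall s t, 0 <= s -> s <= t -> (t - s) * expR (- J t 1) <= occ t - occ s) ->
  (forall t, 0 <= t -> occ t <= K) -> occ n%:R @[n --> \oo] --> K ->
  transient X P.
Proof.
move=> vgt0 vle1 Jle occ_ge occK occ_cvg x x0.
apply: (transience_criterion mX cX) => a a0.
exists (fun m => expR (J 1 1 + a) * (K - occ m%:R)).
  rewrite -[X in _ --> X](mulr0 (expR (J 1 1 + a))); apply: cvgMr.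
  by rewrite -(subrr K); apply: cvgB => //; exact: cvg_cst.
move=> m k N.
set dl : R := (2 ^+ k)^-1.
set t := fun n : nat => (m.+1%:R + n%:R * dl : R).
have p0 : 0 < 2 ^+ k :> R by rewrite exprn_gt0.
have d0 : 0 <= dl by rewrite invr_ge0 ltW.
have d1 : dl <= 1 by rewrite invf_le1// exprn_ege1// ler1n.
have dk : (2 ^ k)%N%:R * dl = 1 by rewrite natrX mulfV// gt_eqF.
have t0 n : 0 <= t n by rewrite addr_ge0// mulr_ge0.
have tS n : t n.+1 = t n + dl by rewrite /t -(natr1 n) mulrDl mul1r addrA.
have tnd : {homo t : i j / (i <= j)%N >-> i <= j}.
  by move=> i j ij; rewrite lerD2l ler_wpM2r// ler_nat.
have id0 (i : nat) : 0 <= i%:R * dl by rewrite mulr_ge0.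
pose G (j : nat) (y : \bar R) := \sum_(i < j) dl * pexp (i%:R * dl) 1 y.
(* the horizon L leaves at least 2 ^ k summands at each of the N steps, that is,
   a time interval of length 1 *)
pose L := (N + 2 ^ k)%N.
pose f (n : nat) w := G (L - n)%N (X (t n) w).
have xE : (0 <= x%:E)%E by rewrite lee_fin.
have bp s (u : nat) i : 0 <= s ->
    bounded_measurable (fun w => dl * pexp (u%:R * dl + i%:R * dl) 1 (X s w)).
  move=> s0; apply: bounded_measurableZ; apply: (bounded_measurable_pexp Phi XP v_ge0) => //.
  by rewrite addr_ge0.
have bp0 s i : 0 <= s -> bounded_measurable (fun w => dl * pexp (i%:R * dl) 1 (X s w)).
  by move=> s0; apply: bounded_measurableZ; apply: (bounded_measurable_pexp Phi XP v_ge0).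
have bG j s : 0 <= s -> bounded_measurable (fun w => G j (X s w)).
  move=> s0; apply: (@bounded_measurable_sum _ _ _
    (fun i w => dl * pexp (i%:R * dl) 1 (X s w))) => i.
  exact: bp0.
have bf n : bounded_measurable (f n) by exact: bG.
have G0 j y : 0 <= G j y.
  by apply: sumr_ge0 => i _; rewrite mulr_ge0// pexp_ge0.
have below (j : nat) (y : \bar R) : (2 ^ k <= j)%N -> (0 <= y)%E -> ~ above a y ->
    expR (- (J 1 1 + a)) <= G j y.
  move=> kj y0 ya.
  have Gnd : G (2 ^ k)%N y <= G j y.
    rewrite /G -(subnK kj) addnC big_split_ord/= lerDl.
    by apply: sumr_ge0 => i _; rewrite mulr_ge0// pexp_ge0.
  apply: le_trans Gnd.
  have -> : expR (- (J 1 1 + a)) = \sum_(i < (2 ^ k)%N) dl * expR (- (J 1 1 + a)).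
    by rewrite sumr_const card_ord -[_ *+ _]mulr_natl mulrA dk mul1r.
  apply: ler_sum => i _; rewrite ler_wpM2l// opprD expRD /(pexp _ _ _).
  have i1 : i%:R * dl <= 1.
    by rewrite -[leRHS]dk ler_wpM2r// ler_nat ltnW.
  apply: ler_pM; [exact: expR_ge0|exact: expR_ge0| |].
    by rewrite ler_expR lerN2; exact: Jle.
  apply: le_trans (eexp_below _ y0 ya); last exact: v_ge0.
  by rewrite ler_expR lerN2 ler_piMl// vle1.
have Ef0 : \int[P x%:E]_w f 0%N w <= K - occ m%:R.
  rewrite /f /G (Rintegral_sum _ _ _ (fun i => bp0 _ i (t0 0%N)))//.
  have RZ (c : R) : 0 <= c ->
      \int[P x%:E]_w (dl * pexp c 1 (X (t 0%N) w)) =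
      dl * \int[P x%:E]_w pexp c 1 (X (t 0%N) w).
    move=> c0; apply: RintegralZl => //; apply: bounded_integrable => //.
    exact: (bounded_measurable_pexp Phi XP v_ge0).
  have h (i : nat) : \int[P x%:E]_w (dl * pexp (i%:R * dl) 1 (X (t 0%N) w)) <=
      occ (t i) - occ (t i - dl).
    rewrite (RZ _ (id0 i)) (expectation_pexp XP absorbed laplace)//; last exact: vgt0.
    have -> : t 0%N + i%:R * dl = t i by rewrite /t mul0r addr0.
    have tm : 0 <= t i - dl.
      by rewrite subr_ge0 (le_trans d1)// (le_trans (_ : 1 <= m.+1%:R)) ?ler1n// lerDl.
    apply: le_trans (occ_ge _ _ tm _); last by rewrite gerBl.
    rewrite opprB addrCA subrr addr0 ler_wpM2l// /(pexp _ _ _)/= ler_piMr ?expR_ge0//.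
    by apply: expRN_le1; rewrite mulr_ge0// v_ge0.
  apply: (@le_trans _ _ (\sum_(i < L - 0) (occ (t i) - occ (t i - dl)))).
    by apply: ler_sum => i _.
  have tel (n : nat) : \sum_(i < n) (occ (t i) - occ (t i - dl)) =
      occ (t n - dl) - occ (t 0%N - dl).
    elim: n => [|n IH]; first by rewrite big_ord0 subrr.
    by rewrite big_ord_recr/= IH tS addrK; lra.
  rewrite tel; apply: lerB.
    apply: occK.
    by rewrite subr_ge0 (le_trans d1)// (le_trans (_ : 1 <= m.+1%:R)) ?ler1n// lerDl.
  rewrite /t mul0r addr0 -subr_ge0; apply: le_trans (occ_ge _ _ _ _) => //.
    by rewrite mulr_ge0 ?expR_ge0// -natr1; lra.
  by rewrite -natr1; lra.
have := @maximal_inequality _ _ _ (P x%:E) (fun n => X (t n) @^-1` above a)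
  (fun n => measurable_above_event mX a (t0 n)) N f (expR (- (J 1 1 + a))) bf.
move=> h; rewrite -(@ler_pM2l _ (expR (- (J 1 1 + a)))) ?expR_gt0//.
rewrite [leRHS]mulrA -expRD addNr expR0 mul1r; apply: le_trans Ef0; apply: h.
- by move=> n w; exact: G0.
- move=> n w nN nC; apply: below nC => //; last exact: Xge0.
  by rewrite /L -addnBAC ?leq_addl// ltnW.
move=> n nN.
have FS : natural_filtration X (t n) (survival (fun i => X (t i) @^-1` above a) n.+1).
  by apply: natural_filtration_survival => //; exact: measurable_above.
have mS := natural_filtration_measurable XP FS.
have LS : (L - n)%N = (L - n.+1).+1 by rewrite subnSK// /L ltn_addr.
rewrite /f LS.
set j := (L - n.+1)%N.
set A := survival _ _.
have -> : \int[P x%:E]_(w in A) G j (X (t n.+1) w) =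
    \int[P x%:E]_(w in A) \sum_(i < j) dl * pexp (1%:R * dl + i%:R * dl) 1 (X (t n) w).
  rewrite /G (Rintegral_sum _ _ mS (fun i => bp0 _ i (t0 n.+1))).
  rewrite (Rintegral_sum _ _ mS (fun i => bp _ 1%N i (t0 n))).
  have RZ s (c : R) : 0 <= s -> 0 <= c ->
      \int[P x%:E]_(w in A) (dl * pexp c 1 (X s w)) =
      dl * \int[P x%:E]_(w in A) pexp c 1 (X s w).
    move=> s0 c0; apply: RintegralZl => //; apply: bounded_integrable => //.
    exact: (bounded_measurable_pexp Phi XP v_ge0).
  apply: eq_bigr => i _; rewrite (RZ _ _ (t0 n.+1) (id0 i)).
  rewrite (RZ _ _ (t0 n) (addr_ge0 (id0 1%N) (id0 i))).
  by rewrite tS (markov_pexp XP absorbed laplace v_ge0) ?mul1r//; exact: vgt0.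
apply: le_Rintegral => //.
- apply: bounded_integrable => //.
  apply: (@bounded_measurable_sum _ _ _
    (fun i w => dl * pexp (1%:R * dl + i%:R * dl) 1 (X (t n) w))) => i.
  exact: bp.
- by apply: bounded_integrable => //; exact: bG.
move=> w _; rewrite /G big_ord_recl/=.
rewrite -[leLHS]add0r; apply: lerD; first by rewrite mulr_ge0// pexp_ge0.
apply: ler_sum => i _; rewrite /bump/= add1n.
by rewrite -mulrDl -natrD add1n.
Qed.

End Transience.

(** * Recurrence *)

Section Recurrence.
Context {R : realType} {d : measure_display} {Omega : measurableType d}.
Variables (X : R -> Omega -> \bar R) (P : \bar R -> probability Omega R).
Variables (Psi Phi : R -> R) (v : R -> R -> R).
Hypothesis XP : markov_process X P.
Hypothesis absorbed : absorbed_at_infinity X.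
Local Notation J := (immigration_exponent Phi v).
Local Notation pexp := (pexp Phi v).
Hypothesis laplace : forall q x t : R, 0 < q -> 0 <= x -> 0 <= t ->
  (\int[P x%:E]_w expeR (- (q%:E * X t w)) = (expR (- (x * v t q) - J t q))%:E)%E.
Hypothesis vflow : cumulant_flow Psi v.
Hypothesis Phi_continuous : continuous (fun q : R => Phi (Num.max q 0)).
Hypothesis Psi0 : Psi 0 = 0.
Hypothesis Psi_ratio : forall a b : R, 0 <= a -> a <= b -> b * Psi a <= a * Psi b.
Hypothesis Psi_gt0 : forall z : R, 0 < z -> 0 < Psi z.
Hypothesis Phi_ge0 : forall z : R, 0 <= z -> 0 <= Phi z.
Hypothesis Phi_ratio : forall a b : R, 0 <= a -> a <= b -> a * Phi b <= b * Phi a.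

Let mX (t : R) : 0 <= t -> measurable_fun setT (X t).
Proof. exact: (markov_measurable XP). Qed.

Let Xge0 (t : R) w : 0 <= t -> (0 <= X t w)%E.
Proof. exact: (markov_state XP). Qed.

Let v_ge0 (q t : R) : 0 < q -> 0 <= t -> 0 <= v t q.
Proof. by move=> q0 t0; exact: (flow_ge0 vflow q0 t0). Qed.

Let v_gt0 (q t : R) : 0 < q -> 0 <= t -> 0 < v t q.
Proof. by move=> q0 t0; exact: (flow_gt0 vflow Psi0 Psi_ratio Psi_gt0 q0 t0). Qed.

Let J_le (q s t : R) : 0 < q -> 0 <= s -> s <= t -> J s q <= J t q.
Proof.
move=> q0 s0 st.
exact: (immigration_exponent_nondecreasing vflow Phi_continuous q0 Phi_ge0 s0 st).
Qed.

Let J_ge0 (q t : R) : 0 < q -> 0 <= t -> 0 <= J t q.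
Proof.
by move=> q0 t0; have := J_le q0 (lexx 0) t0; rewrite immigration_exponent0.
Qed.

Let pexp0 (q : R) y : 0 < q -> pexp 0 q y = eexp q y.
Proof.
move=> q0; rewrite /(pexp _ _ _) immigration_exponent0 (flow0 vflow q0).
by rewrite oppr0 expR0 mul1r.
Qed.

Let pexp_le (t q : R) y : 0 < q -> 0 <= t -> (0 <= y)%E -> pexp t q y <= expR (- J t q).
Proof.
by move=> q0 t0 y0; rewrite /(pexp _ _ _) ler_piMr ?expR_ge0// eexp_le1// v_ge0.
Qed.

(** [pexpD] at the state [0]. *)
Let J_flow (q s t : R) : 0 < q -> 0 <= s -> 0 <= t -> J (s + t) q = J t q + J s (v t q).
Proof.
move=> q0 s0 t0.
have pz (s' q' : R) : pexp s' q' 0%E = expR (- J s' q').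
  by rewrite /(pexp _ _ _)/= mulr0 oppr0 expR0 mulr1.
have := pexpD XP absorbed laplace q0 (v_gt0 q0 t0) s0 t0 (lexx 0%E).
rewrite (pz (s + t)) (pz s) -expRD => /expR_inj.
lra.
Qed.

Section Skeleton.
(** The process is observed at the times [t n = (m + n) dl], where [dl] is the
    time that the flow takes to go down from [K] to [Z]. *)
Variables (Z K dl a : R) (m : nat).
Hypothesis Z0 : 0 < Z.
Hypothesis ZK : Z < K.
Hypothesis dl0 : 0 < dl.
Hypothesis flowKZ : v dl K = Z.
Hypothesis a_large : ln 2 + J dl K <= (K - Z) * a.
Variable x : R.
Hypothesis x0 : 0 <= x.
Let t (n : nat) : R := (m + n)%N%:R * dl.
Let Q := P x%:E.
Let S N := survival (fun n => X (t n) @^-1` above a) N.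
Let g N := \sum_(i < N) expR (- J (i%:R * dl) Z).
Let kappa := expR (- J dl K).

Let K0 : 0 < K. Proof. exact: lt_trans ZK. Qed.
Let xE : (0 <= x%:E)%E. Proof. by rewrite lee_fin. Qed.
Let t0 n : 0 <= t n. Proof. by rewrite mulr_ge0// ltW. Qed.
Let id0 (i : nat) : 0 <= i%:R * dl. Proof. by rewrite mulr_ge0// ltW. Qed.
Let tS n : t n.+1 = t n + dl.
Proof. by rewrite /t addnS -natr1 mulrDl mul1r. Qed.
Let tnd : {homo t : i j / (i <= j)%N >-> i <= j}.
Proof. by move=> i j ij; rewrite /t ler_wpM2r ?(ltW dl0)// ler_nat leq_add2l. Qed.

Let FS n : natural_filtration X (t n) (S n.+1).
Proof. by apply: natural_filtration_survival => //; exact: measurable_above. Qed.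

Let mA n : measurable (X (t n) @^-1` above a).
Proof. exact: (measurable_above_event mX). Qed.

Let mS n : measurable (S n).
Proof. exact: measurable_survival. Qed.

Let be (n : nat) (q : R) : 0 < q -> bounded_measurable (fun w => eexp q (X (t n) w)).
Proof. by move=> q0; apply: (bounded_measurable_eexp XP) => //; exact: ltW. Qed.

Let bp (n : nat) (s q : R) : 0 < q -> 0 <= s ->
  bounded_measurable (fun w => pexp s q (X (t n) w)).
Proof. by move=> q0 s0; exact: (bounded_measurable_pexp Phi XP v_ge0). Qed.

Let eexp_lyapunov y : above a y -> eexp K y + kappa / 2 * eexp Z y <= pexp dl K y.
Proof.
rewrite /above/= /(pexp _ _ _) flowKZ -/kappa; case: y => [r| |]//=; last by rewrite !mulr0 addr0.
rewrite lee_fin => ar.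
suff h : expR (- (K * r)) <= kappa / 2 * expR (- (Z * r)) by lra.
have -> : kappa / 2 * expR (- (Z * r)) = expR (- J dl K - ln 2 - Z * r).
  have e2 : expR (- ln 2) = 2^-1 :> R by rewrite expRN lnK// posrE.
  by rewrite !expRD e2.
rewrite ler_expR.
have : (K - Z) * a <= (K - Z) * r by rewrite ler_wpM2l// subr_ge0 ltW.
have := a_large; rewrite !mulrBl; lra.
Qed.

(** [eexp K] is a Lyapunov function above level [a]. *)
Let collected N : kappa / 2 * \sum_(n < N) \int[Q]_(w in S n.+1) eexp Z (X (t n) w) <= 1.
Proof.
apply: (@lyapunov_bound _ _ _ Q (fun n => X (t n) @^-1` above a) mA N
  (fun n w => eexp K (X (t n) w)) (fun n w => eexp Z (X (t n) w)) (kappa / 2)).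
- by move=> n; exact: be.
- by move=> n w; rewrite eexp_ge0 (eexp_le1 (ltW K0) (Xge0 w (t0 n))).
move=> n.
have -> : \int[Q]_(w in S n.+1) eexp K (X (t n.+1) w) =
    \int[Q]_(w in S n.+1) pexp dl K (X (t n) w).
  have v0K : 0 < v 0 K by exact: v_gt0.
  have := markov_pexp XP absorbed laplace v_ge0 K0 v0K (t0 n) (ltW dl0) (lexx 0) xE (@FS n).
  rewrite -tS addr0 => <-.
  by apply: eq_Rintegral => w _; rewrite pexp0.
have iZ := bounded_integrable Q (be n Z0) (mS n.+1).
rewrite -RintegralZl// -RintegralD//; last first.
- exact: integrable_scale.
- exact: (bounded_integrable Q (be n K0) (mS n.+1)).
apply: le_Rintegral => //.
- apply: bounded_integrable => //; apply: bounded_measurableD; first exact: be.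
  by apply: bounded_measurableZ; exact: be.
- by apply: bounded_integrable => //; apply: bp => //; exact: ltW.
move=> w Sw; apply: eexp_lyapunov.
by move: Sw; rewrite /S survivalS => -[].
Qed.

Let g_mono (i j : nat) : (i <= j)%N -> g i <= g j.
Proof.
move=> ij; rewrite /g -(subnK ij) addnC big_split_ord/= lerDl.
by apply: sumr_ge0 => k _; exact: expR_ge0.
Qed.

(** [G (N - n)] is the reward expected between the steps [n] and [N]. *)
Let first_passage N : \sum_(i < N) pexp (t i) Z x%:E <=
  (kappa / 2)^-1 + g N * (1 - fine (Q (S N))).
Proof.
pose G (j : nat) (y : \bar R) := \sum_(i < j) pexp (i%:R * dl) Z y.
have bG j n : bounded_measurable (fun w => G j (X (t n) w)).
  apply: (@bounded_measurable_sum _ _ _ (fun i w => pexp (i%:R * dl) Z (X (t n) w))) => i.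
  exact: bp.
have := @first_passage_bound _ _ _ Q (fun n => X (t n) @^-1` above a) mA N
  (fun n w => G (N - n)%N (X (t n) w)) (fun n w => eexp Z (X (t n) w)) (g N)
  (fun n => bG _ _).
have -> : \int[Q]_w G (N - 0)%N (X (t 0%N) w) = \sum_(i < N) pexp (t i) Z x%:E.
  rewrite /G subn0.
  rewrite (@Rintegral_sum _ _ _ Q (fun i w => pexp (i%:R * dl) Z (X (t 0%N) w)))//; last first.
    by move=> i; exact: bp.
  apply: eq_bigr => i _; rewrite (expectation_pexp XP absorbed laplace)//; last exact: v_gt0.
  have -> // : t 0%N + i%:R * dl = t i by rewrite /t -mulrDl -natrD addn0.
move=> h; apply: le_trans (h _ _ _) _ => {h}.
- move=> n w; apply: (@le_trans _ _ (\sum_(i < N - n) expR (- J (i%:R * dl) Z))).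
    by apply: ler_sum => i _; apply: pexp_le => //; exact: Xge0.
  exact: g_mono (leq_subr n N).
- by move=> w; rewrite /G subnn big_ord0.
- move=> n nN; rewrite -subnSK//; set j := (N - n.+1)%N.
  have -> : \int[Q]_(w in S n.+1) G j (X (t n.+1) w) =
      \int[Q]_(w in S n.+1) \sum_(i < j) pexp (dl + i%:R * dl) Z (X (t n) w).
    rewrite (@Rintegral_sum _ _ _ Q
      (fun i w => pexp (i%:R * dl) Z (X (t n.+1) w)) _ _ (mS n.+1)); last first.
      by move=> i; exact: bp.
    rewrite (@Rintegral_sum _ _ _ Q
      (fun i w => pexp (dl + i%:R * dl) Z (X (t n) w)) _ _ (mS n.+1)); last first.
      by move=> i; apply: bp => //; rewrite addr_ge0// ltW.
    apply: eq_bigr => i _; rewrite tS.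
    by rewrite (markov_pexp XP absorbed laplace v_ge0)//; [exact: v_gt0|exact: ltW].
  rewrite -RintegralD//; last first.
  + apply: bounded_integrable => //.
    apply: (@bounded_measurable_sum _ _ _ (fun i w => pexp (dl + i%:R * dl) Z (X (t n) w))) => i.
    by apply: bp => //; rewrite addr_ge0// ltW.
  + exact: (bounded_integrable Q (be n Z0) (mS n.+1)).
  have -> // : \int[Q]_(w in S n.+1) G j.+1 (X (t n) w) = \int[Q]_(w in S n.+1)
      (eexp Z (X (t n) w) + \sum_(i < j) pexp (dl + i%:R * dl) Z (X (t n) w)).
  apply: eq_Rintegral => w _; rewrite /G big_ord_recl/= mul0r pexp0//.
  congr (_ + _); apply: eq_bigr => i _; rewrite /bump/= add1n.
  by rewrite -natr1 mulrDl mul1r addrC.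
rewrite lerD2r -(@ler_pM2l _ (kappa / 2)); last by rewrite divr_gt0// expR_gt0.
rewrite mulfV; last by rewrite gt_eqF// divr_gt0// expR_gt0.
exact: collected.
Qed.

Let g_le (N : nat) : g N <= N%:R.
Proof.
rewrite -[leRHS]mulr1 mulr_natl -[N in leRHS]card_ord -sumr_const.
by apply: ler_sum => i _; apply: expRN_le1; exact: J_ge0.
Qed.

(** The reward collected from time [t 0] on is asymptotically the same from [x]
    as from [0], because the flow tends to [0]. *)
Let reward_lower (e : R) : 0 < e -> exists C : R, forall N,
  (1 - e) * g N - C <= \sum_(i < N) pexp (t i) Z x%:E.
Proof.
move=> e0; have x1 : 0 < 1 + x by rewrite ltr_pwDl.
have [T T0 vT] : exists2 T : R, 0 <= T & v T Z < e / (1 + x).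
  by apply: (flow_small vflow Psi0 Psi_ratio Psi_gt0 Z0); rewrite divr_gt0.
have late s : T <= s -> (1 - e) * expR (- J s Z) <= pexp s Z x%:E.
  move=> Ts; have s0 : 0 <= s by exact: le_trans Ts.
  rewrite /(pexp _ _ _)/= mulrC ler_wpM2l ?expR_ge0//.
  have vs : v s Z < e / (1 + x).
    apply: le_lt_trans vT.
    exact: (flow_nonincreasing vflow Psi0 Psi_gt0 Z0 T0 Ts).
  have := expR_ge1Dx (- (v s Z * x)).
  have : v s Z * (1 + x) < e by rewrite -ltr_pdivlMr.
  have := v_ge0 Z0 s0; nra.
pose i0 := Num.bound (T / dl).
have Ti0 i : (i0 <= i)%N -> T <= t i.
  move=> i0i; rewrite /t -ler_pdivrMr//.
  apply: le_trans (ltW (archi_boundP (divr_ge0 T0 (ltW dl0)))) _.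
  by rewrite ler_nat (leq_trans i0i)// leq_addl.
exists (`|1 - e| * m%:R + `|1 - e| * i0%:R) => N.
have early : \sum_(i < N) (i < i0)%N%:R <= i0%:R :> R.
  rewrite -natr_sum ler_nat; suff -> : (\sum_(i < N) (i < i0)%N = minn N i0)%N.
    exact: geq_minr.
  elim: N => [|N IH]; first by rewrite big_ord0 min0n.
  rewrite big_ord_recr/= IH; case: ltnP => h.
    by rewrite (minn_idPl h) addn1.
  by rewrite (minn_idPr (leqW h)) addn0.
have shift : \sum_(i < N) expR (- J (t i) Z) = g (m + N)%N - g m.
  by rewrite /g big_split_ord/= addrC addrK.
apply: (@le_trans _ _ (\sum_(i < N) ((1 - e) * expR (- J (t i) Z) - `|1 - e| * (i < i0)%N%:R))).
  rewrite sumrB -!mulr_sumr shift.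
  have h1 := g_mono (leq_addl m N); have h2 := g_le m.
  have h3 : g N <= g (m + N)%N - g m + m%:R by lra.
  have h4 : g (m + N)%N - g m <= g N.
    rewrite -shift; apply: ler_sum => i _; rewrite ler_expR lerN2 J_le//.
    by rewrite /t ler_wpM2r ?(ltW dl0)// ler_nat leq_addl.
  have h5 := ler_norm (1 - e); have h6 := normr_ge0 (1 - e).
  have h7 : `|1 - e| * \sum_(i < N) (i < i0)%N%:R <= `|1 - e| * i0%:R.
    by rewrite ler_wpM2l.
  have h8 : 0 <= g N - (g (m + N)%N - g m) by lra.
  have h9 : (1 - e) * (g N - (g (m + N)%N - g m)) <= `|1 - e| * m%:R.
    apply: (@le_trans _ _ (`|1 - e| * (g N - (g (m + N)%N - g m)))).
      by rewrite ler_wpM2r.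
    by rewrite ler_wpM2l//; lra.
  lra.
apply: ler_sum => i _; case: ltnP => ii.
  rewrite mulr1; apply: (@le_trans _ _ 0); last exact: pexp_ge0.
  rewrite subr_le0; apply: (@le_trans _ _ (`|1 - e| * expR (- J (t i) Z))).
    by rewrite ler_wpM2r ?expR_ge0// ler_norm.
  rewrite ler_piMr//; apply: expRN_le1; exact: J_ge0.
by rewrite mulr0 subr0; apply: late; exact: Ti0.
Qed.

(** Writing [g] for the reward collected from [0], [reward_lower] and
    [first_passage] give [(1 - e / 2) g N <= g N P(killed before N) + C];
    divide by [g N]. *)
Lemma survival_small (e : R) : (forall M : R, exists N, M <= g N) -> 0 < e ->
  exists N, fine (Q (S N)) <= e.
Proof.
move=> g_unbounded e0.
have e20 : 0 < e / 2 by rewrite divr_gt0.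
have [C hC] := reward_lower e20.
have [N hN] := g_unbounded (Num.max 1 ((C + (kappa / 2)^-1) / (e / 2))).
exists N.
have gN1 : 1 <= g N by apply: le_trans hN; rewrite le_max lexx.
have gN2 : C + (kappa / 2)^-1 <= e / 2 * g N.
  rewrite [leRHS]mulrC -ler_pdivrMr//; apply: le_trans hN.
  by rewrite le_max lexx orbT.
have h1 := hC N; have h2 := first_passage N.
have gN0 : 0 < g N by lra.
rewrite -(ler_pM2l gN0).
lra.
Qed.

End Skeleton.

(** As [Phi / Psi] is nonincreasing, this is its limit at infinity: the level at
    which, asymptotically, immigration balances the downward drift of
    branching. *)
Definition bottom_level : R := inf [set Phi z / Psi z | z in [set z : R | 0 < z]].
Local Notation xb := bottom_level.

Let quot_ge0 (z : R) : 0 < z -> 0 <= Phi z / Psi z.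
Proof. by move=> z0; rewrite divr_ge0 ?Phi_ge0 ?ltW// Psi_gt0. Qed.

Let quot_inf : has_inf [set Phi z / Psi z | z in [set z : R | 0 < z]].
Proof.
split; first by exists (Phi 1 / Psi 1), 1 => /=.
by exists 0 => _ [z z0 <-]; exact: quot_ge0.
Qed.

Lemma bottom_level_ge0 : 0 <= xb.
Proof.
apply: lb_le_inf; first by case: quot_inf.
by move=> _ [z z0 <-]; exact: quot_ge0.
Qed.

Lemma bottom_level_le (z : R) : 0 < z -> xb * Psi z <= Phi z.
Proof.
move=> z0; rewrite -ler_pdivlMr ?Psi_gt0//; apply: ge_inf; first by case: quot_inf.
by exists z.
Qed.

(** [Phi / Psi] is nonincreasing by concavity of [Phi] and convexity of
    [Psi]. *)
Lemma bottom_level_ub (a : R) : xb < a ->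
  exists2 Z : R, 1 < Z & forall z, Z <= z -> Phi z <= a * Psi z.
Proof.
move=> xa; have xa0 : 0 < a - xb by rewrite subr_gt0.
have [_ [y /= y0 <-]] := inf_adherent xa0 quot_inf.
rewrite -/xb addrC subrK ltr_pdivrMr ?Psi_gt0// => ya.
exists (1 + y); first by rewrite ltrDl.
move=> z yz; have yz' : y <= z by lra.
have h1 := Phi_ratio (ltW y0) yz'; have h2 := Psi_ratio (ltW y0) yz'.
have a0 : 0 <= a by rewrite (le_trans bottom_level_ge0)// ltW.
have z0 : 0 < z by lra.
rewrite -(ler_pM2l y0); apply: le_trans h1 _.
apply: (@le_trans _ _ (z * (a * Psi y))); first by rewrite ler_pM2l// ltW.
by rewrite mulrCA [leRHS]mulrCA ler_wpM2l.
Qed.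

(** By [bottom_level_le], [J t q >= xb (q - v t q)], so that the expectation
    of [exp (- q X_t)] is at most [exp (- q xb)]; let [q] tend to infinity in
    the Markov inequality. *)
Lemma above_bottom_level (e t : R) : 0 < e -> 0 <= t ->
  P xb%:E (~` (X t @^-1` above (xb - e))) = 0%E.
Proof.
move=> e0 t0.
set E := ~` _.
have mE : measurable E by apply: measurableC; exact: (measurable_above_event mX).
have xb0 : (0 <= xb%:E)%E by rewrite lee_fin bottom_level_ge0.
have EP w : E w -> exists2 r, X t w = r%:E & r <= xb - e.
  rewrite /E /above /=; have := Xge0 w t0; case: (X t w) => [r| |]//=.
    by rewrite !lee_fin => _ /negP; rewrite -ltNge => h; exists r => //; exact: ltW.
  by move=> _ []; rewrite leey.
have ub (q : R) : 0 < q -> fine (P xb%:E E) <= expR (- (q * e)).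
  move=> q0; have q00 := ltW q0.
  have be := bounded_measurable_eexp XP t0 q00.
  have h1 : expR (- (q * (xb - e))) * fine (P xb%:E E) <=
      \int[P xb%:E]_(w in E) eexp q (X t w).
    apply: Rintegral_ge_cst => // w /EP[r -> rx] /=.
    by rewrite ler_expR lerN2 ler_wpM2l.
  have h2 : \int[P xb%:E]_(w in E) eexp q (X t w) <= \int[P xb%:E]_w eexp q (X t w).
    rewrite (Rintegral_split (P xb%:E) be measurableT mE) setTI lerDl.
    by apply: Rintegral_ge0 => w _; exact: eexp_ge0.
  have h3 : \int[P xb%:E]_w eexp q (X t w) <= expR (- (q * xb)).
    rewrite (expectation_eexp XP absorbed laplace)// /(pexp _ _ _)/= -expRD ler_expR.
    have := @immigration_exponent_ge R Psi Phi v vflow Phi_continuous q q0 xb 0 t (lexx 0) t0.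
    rewrite (flow0 vflow q0) immigration_exponent0 => h.
    have {}h := h _; move: h; have hh (s : R) : 0 < s -> s < t ->
        xb * Psi (v s q) <= Phi (v s q).
      by move=> s0 _; apply: bottom_level_le; apply: v_gt0 => //; exact: ltW.
    by move=> /(_ hh); lra.
  have -> : expR (- (q * e)) = expR (q * (xb - e)) * expR (- (q * xb)).
    by rewrite -expRD; congr expR; ring.
  rewrite -(@ler_pM2l _ (expR (- (q * (xb - e))))) ?expR_gt0//.
  rewrite mulrA -expRD addNr expR0 mul1r.
  exact: le_trans h1 (le_trans h2 h3).
apply/eqP; rewrite -(@fineK _ (P xb%:E E)) ?fin_num_measure// eqe.
rewrite eq_le fine_ge0// andbT leNgt; apply/negP => p0.
set p := fine _ in ub p0.
have pe0 : 0 < p * e by rewrite mulr_gt0.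
have := ub (p * e)^-1; rewrite invr_gt0 => /(_ pe0); apply/negP; rewrite -ltNge.
rewrite expRN invf_plt ?posrE ?expR_gt0//.
have -> : (p * e)^-1 * e = p^-1 by field; lra.
by apply: lt_le_trans (expR_ge1Dx _); rewrite ltrDr.
Qed.


(** Since the flow takes a time [T] from [Z] to [1], the exponent [J s Z]
    exceeds [J s 1] by at most [J T Z]. *)
Let reward_unbounded (occ : R -> R) (Z dl : R) : 1 < Z -> 0 < dl ->
  (forall s t, 0 <= s -> s <= t -> occ s <= occ t) ->
  (forall s t, 0 <= s -> s <= t -> occ t - occ s <= (t - s) * expR (- J s 1)) ->
  (forall M : R, exists n : nat, M <= occ n%:R) ->
  forall M : R, exists N, M <= \sum_(i < N) expR (- J (i%:R * dl) Z).
Proof.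
move=> Z1 dl0 occ_nd occ_le occ_unb M.
have Z0 : 0 < Z by lra.
have [T T0 vT] := flow_onto vflow Psi0 Psi_ratio Psi_gt0 Z0 ltr01 Z1.
have id0 (i : nat) : 0 <= i%:R * dl by rewrite mulr_ge0// ltW.
pose c := expR (- J T Z); have c0 : 0 < c by exact: expR_gt0.
have [n hn] := occ_unb (`|M| * dl / c + occ 0).
exists (Num.bound (n%:R / dl)); set N := Num.bound _.
have nN : n%:R <= N%:R * dl.
  by rewrite -ler_pdivrMr// ltW// archi_boundP// divr_ge0// ltW.
have tel (k : nat) : occ (k%:R * dl) - occ 0 <= \sum_(i < k) dl * expR (- J (i%:R * dl) 1).
  elim: k => [|k IH]; first by rewrite big_ord0 mul0r subrr.
  rewrite big_ord_recr/=.
  have kk : k.+1%:R * dl = k%:R * dl + dl by rewrite -natr1 mulrDl mul1r.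
  have := occ_le _ _ (id0 k) (_ : _ <= k.+1%:R * dl).
  rewrite kk lerDl => /(_ (ltW dl0)); rewrite addrAC subrr add0r.
  lra.
have occN := occ_nd _ _ (ler0n R n) nN.
have := tel N; rewrite -mulr_sumr => hN.
have cmp : c * \sum_(i < N) expR (- J (i%:R * dl) 1) <= \sum_(i < N) expR (- J (i%:R * dl) Z).
  rewrite mulr_sumr; apply: ler_sum => i _; rewrite -expRD ler_expR -opprD lerN2.
  have JF : J (i%:R * dl + T) Z = J T Z + J (i%:R * dl) 1.
    by rewrite (J_flow Z0 (id0 i) (ltW T0)) vT.
  by rewrite -JF; apply: J_le => //; rewrite lerDl ltW.
apply: le_trans cmp; apply: le_trans (ler_norm M) _.
set s := \sum_(_ < _) _ in hN *.
have : `|M| * dl / c <= dl * s by lra.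
rewrite ler_pdivrMr// => h1; rewrite -(ler_pM2r dl0); lra.
Qed.

(** From [xb], the skeletons of all the mesh sizes [dl k] almost surely stay
    above [xb] and return below [xb + 1 / (k + 1)] after any given time. *)
Lemma bottom_level_recurrent (occ : R -> R) :
  (forall s t, 0 <= s -> s <= t -> occ s <= occ t) ->
  (forall s t, 0 <= s -> s <= t -> occ t - occ s <= (t - s) * expR (- J s 1)) ->
  (forall M : R, exists n : nat, M <= occ n%:R) ->
  recurrent X P.
Proof.
move=> occ_nd occ_le occ_unb.
have step (k : nat) : exists dl : R, 0 < dl /\ forall (m : nat) (e : R), 0 < e ->
    exists N, fine (P xb%:E (survival (fun n => X ((m + n)%N%:R * dl) @^-1`
      above (xb + k.+1%:R^-1)) N)) <= e.
  have k0 : 0 < k.+1%:R^-1 :> R by rewrite invr_gt0.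
  set h := k.+1%:R^-1 in k0 *.
  have [|Z Z1 hZ] := @bottom_level_ub (xb + h / 2); first by rewrite ltrDl divr_gt0.
  have Z0 : 0 < Z by lra.
  (* so that (K - Z) * h / 2 = ln 2, the slack that [a_large] requires *)
  pose K := Z + 2 / h * ln 2.
  have l2 : 0 < ln 2 :> R by rewrite ln_gt0// ltr1n.
  have ZK : Z < K by rewrite ltrDl mulr_gt0// divr_gt0.
  have K0 : 0 < K by exact: lt_trans ZK.
  have [dl dl0 vdl] := flow_onto vflow Psi0 Psi_ratio Psi_gt0 K0 Z0 ZK.
  exists dl; split => // m e e0.
  have JK : J dl K <= (xb + h / 2) * (K - Z).
    have := @immigration_exponent_le R Psi Phi v vflow Phi_continuous K K0
      (xb + h / 2) 0 dl (lexx 0) (ltW dl0).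
    rewrite immigration_exponent0 (flow0 vflow K0) vdl subr0; apply => s s0 sdl.
    apply: hZ; rewrite -vdl.
    exact: (flow_nonincreasing vflow Psi0 Psi_gt0 K0 (ltW s0) (ltW sdl)).
  have KZ : (K - Z) * (h / 2) = ln 2 by rewrite /K; field; rewrite gt_eqF.
  have a_large : ln 2 + J dl K <= (K - Z) * (xb + h) by lra.
  have := @survival_small Z K dl (xb + h) m Z0 ZK dl0 vdl a_large xb bottom_level_ge0 e _ e0.
  apply.
  exact: (reward_unbounded Z1 dl0 occ_nd occ_le occ_unb).
have [dl /all_and2[dl0 hdl]] := choice step.
pose S k m N := survival (fun n => X ((m + n)%N%:R * dl k) @^-1` above (xb + k.+1%:R^-1)) N.
have td k (n : nat) : 0 <= n%:R * dl k by rewrite mulr_ge0// ltW.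
have mS k m N : measurable (S k m N).
  by apply: measurable_survival => n; exact: (measurable_above_event mX).
have n1 k m : (P xb%:E).-negligible (\bigcap_N S k m N).
  have mI : measurable (\bigcap_N S k m N) by apply: bigcap_measurable => //; exists 0%N.
  exists (\bigcap_N S k m N); split => //.
  apply/eqP; rewrite eq_le measure_ge0 andbT; apply/lee_addgt0Pr => e e0.
  have [N hN] := hdl k m e e0; rewrite add0e.
  apply: (@le_trans _ _ (P xb%:E (S k m N))).
    by apply: le_measure; rewrite ?inE//; exact: bigcap_inf.
  by rewrite -(@fineK _ (P _ _)) ?fin_num_measure// lee_fin.
have n2 k n j : (P xb%:E).-negligible (~` (X (n%:R * dl k) @^-1` above (xb - j.+1%:R^-1))).
  eexists; split; last exact: subset_refl.
    by apply: measurableC; exact: (measurable_above_event mX).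
  by apply: above_bottom_level; rewrite ?invr_gt0.
exists xb; first exact: bottom_level_ge0.
have N1 : (P xb%:E).-negligible (\bigcup_k \bigcup_m \bigcap_N S k m N).
  by apply: negligible_bigcup => k; apply: negligible_bigcup => m; exact: n1.
have N2 : (P xb%:E).-negligible (\bigcup_k \bigcup_n \bigcup_j
    ~` (X (n%:R * dl k) @^-1` above (xb - j.+1%:R^-1))).
  by apply: negligible_bigcup => k; apply: negligible_bigcup => n;
    apply: negligible_bigcup => j; exact: n2.
apply: negligibleS (negligibleU N1 N2) => w /= nlim.
apply: contrapT => good; apply: nlim.
have low k (n : nat) : (xb%:E <= X (n%:R * dl k) w)%E.
  apply/lee_subgt0Pr => e e0.
  pose j := Num.bound e^-1.
  have je : j.+1%:R^-1 <= e.
    rewrite invf_ple ?posrE// ltW//; apply: lt_le_trans (archi_boundP _) _.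
      by rewrite invr_ge0 ltW.
    by rewrite ler_nat.
  apply: (@le_trans _ _ (xb - j.+1%:R^-1)%:E).
    by rewrite -EFinB lee_fin lerB.
  apply: contrapT => h; apply: good; right.
  by exists k => //; exists n => //; exists j.
have high k (m : nat) : exists2 n, (m <= n)%N & (X (n%:R * dl k) w < (xb + k.+1%:R^-1)%:E)%E.
  have [N SN] : exists N, ~ S k m N w.
    apply/existsNP => h; apply: good; left; exists k => //; exists m => // N _; exact: h.
  apply: contrapT => h; apply: SN => n /= _.
  rewrite /above/= leNgt; apply/negP => Xn; apply: h.
  by exists (m + n)%N => //; exact: leq_addr.
rewrite limf_einfE; apply/eqP; rewrite eq_le; apply/andP; split.
  apply: ge_ereal_sup => _ [V [M [Mreal hM]] <-].
  apply/lee_addgt0Pr => e e0; rewrite add0e.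
  pose k := Num.bound e^-1.
  have ke : k.+1%:R^-1 <= e.
    rewrite invf_ple ?posrE// ltW//; apply: lt_le_trans (archi_boundP _) _.
      by rewrite invr_ge0 ltW.
    by rewrite ler_nat.
  pose m := Num.bound (`|M| / dl k).
  have [n mn Xn] := high k m.
  have MV : V (n%:R * dl k).
    apply: hM; rewrite -ltr_pdivrMr//; apply: le_lt_trans (ler_norm _) _.
    rewrite normrM (gtr0_norm (_ : 0 < (dl k)^-1)) ?invr_gt0//.
    apply: lt_le_trans (archi_boundP _) _; first by rewrite divr_ge0// ltW.
    by rewrite ler_nat.
  apply: (@le_trans _ _ `|X (n%:R * dl k) w - xb%:E|%E).
    by apply: ereal_inf_lbound; exists (n%:R * dl k).
  move: Xn (low k n); case: (X _ w) => [r| |]//=.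
  rewrite lte_fin !lee_fin => rx xr; rewrite ger0_norm; last by rewrite subr_ge0.
  by rewrite lerBlDl (le_trans (ltW rx))// lerD2l.
apply: (@le_trans _ _ (ereal_inf ((fun t => `|X t w - xb%:E|%E) @` setT))).
  by apply: le_ereal_inf_tmp => _ [t _ <-]; exact: abse_ge0.
by apply: ereal_sup_ubound; exists setT => //; exact: filterT.
Qed.

End Recurrence.

(** * The dichotomy *)

Section SupercriticalRoot.
Context {R : realType}.
Variable Psi : R -> R.
Hypothesis Psi_continuous : continuous (fun q : R => Psi (Num.max q 0)).
Hypothesis Psi_ratio : forall a b : R, 0 <= a -> a <= b -> b * Psi a <= a * Psi b.

(** A zero exists by continuity; the signs on both sides follow since [Psi y
    / y] is nondecreasing. *)
Lemma supercritical_root (z q : R) : 0 < z -> Psi z < 0 -> 0 < q -> 0 < Psi q ->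
  exists rho, [/\ 0 < rho, forall y, 0 <= y -> y <= rho -> Psi y <= 0 &
    forall y, rho <= y -> 0 <= Psi y].
Proof.
move=> z0 Pz q0 Pq.
have zq : z <= q.
  rewrite leNgt; apply/negP => qz; have := Psi_ratio (ltW q0) (ltW qz).
  have : 0 < z * Psi q by rewrite mulr_gt0.
  have : q * Psi z < 0 by rewrite pmulr_rlt0.
  lra.
have [|rho] := @IVT R Psi z q 0 zq (within_max0_continuous (ltW z0) Psi_continuous).
  by rewrite ge_min le_max (ltW Pz) (ltW Pq) orbT.
rewrite in_itv/= => /andP[zr _] Pr; have r0 : 0 < rho by exact: lt_le_trans zr.
exists rho; split => // y.
  move=> y0 yr; have := Psi_ratio y0 yr; rewrite Pr mulr0.
  by rewrite pmulr_rle0.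
move=> ry; have := Psi_ratio (ltW r0) ry; rewrite Pr mulr0.
by rewrite pmulr_rge0.
Qed.

End SupercriticalRoot.

Theorem theorem2 (R : realType) (gamma sigma b : R)
    (levyPsi levyPhi : {measure set (measurableTypeR R) -> \bar R})
    (Psi := branching_mechanism gamma sigma levyPsi)
    (Phi := immigration_mechanism b levyPhi)
    (d : measure_display) (Omega : measurableType d)
    (X : R -> Omega -> \bar R) (P : \bar R -> probability Omega R) :
  0 <= sigma -> 0 <= b ->
  branching_levy_measure levyPsi -> immigration_levy_measure levyPhi ->
  [\/ sigma <> 0, levyPsi `]0, +oo[%classic <> 0%E | levyPhi `]0, +oo[%classic <> 0%E] ->
  (exists2 q, 0 <= q & 0 < Psi q) ->
  (exists2 q, 0 <= q & Phi q <> 0) ->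
  CBI X P Psi Phi ->
  let I := (\int[lebesgue_measure]_(z in `]0%R, 1%R[)
    ((Psi z)^-1 * expR (- (\int[lebesgue_measure]_(x in `[z, 1%R])
                             (Phi x / Psi x))%R))%:E)%E in
  ((0 <= derive_at_0p Psi)%E ->
     (I = +oo%E -> recurrent X P) /\ ((I < +oo)%E -> transient X P)) /\
  ((derive_at_0p Psi < 0)%E -> transient X P).
Proof.
move=> sigma0 b0 lPsi lPhi _ posPsi nzPhi [XP absorbed _ cX [v vflow laplace]] I.
have Psi0 : Psi 0 = 0 by exact: branching_mechanism0.
have Psi_continuous := @branching_mechanism_continuous R levyPsi lPsi gamma sigma.
have Psi_ratio := @branching_mechanism_ratio R levyPsi lPsi gamma sigma.
have Phi_continuous := @immigration_mechanism_continuous R levyPhi lPhi b.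
have Phi_ratio := @immigration_mechanism_ratio R levyPhi lPhi b.
have Phi_ge0 := @immigration_mechanism_ge0 R levyPhi b b0.
have Phi_gt0 := immigration_mechanism_gt0 lPhi b0 nzPhi.
have v_ge0 (q t : R) : 0 < q -> 0 <= t -> 0 <= v t q.
  by move=> q0 t0; exact: (flow_ge0 vflow q0 t0).
split; last first.
  move=> /(supercritical_neg lPsi)[z z0 Pz].
  have [q q0 Pq] := posPsi.
  have q1 : 0 < q.
    rewrite lt_neqAle q0 andbT; apply/eqP => q00.
    by move: Pq; rewrite -q00 Psi0 ltxx.
  have [rho [r0 neg pos]] := supercritical_root Psi_continuous Psi_ratio z0 Pz q1 Pq.
  apply: (rest_point_transient XP absorbed cX laplace v_ge0 r0) => [t t0|].
    exact: (flow_rest_point vflow r0 t0 neg pos).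
  exact: Phi_gt0.
move=> crit; have Psi_gt0 := subcritical_gt0 lPsi crit posPsi.
have v_gt0 (t : R) : 0 <= t -> 0 < v t 1.
  by move=> t0; exact: (flow_gt0 vflow Psi0 Psi_ratio Psi_gt0 ltr01 t0).
have v_le1 (t : R) : 0 <= t -> v t 1 <= 1.
  by move=> t0; exact: (flow_le vflow Psi0 Psi_gt0 ltr01 t0).
pose occ := occupation Phi v.
have occ_bounds (s t : R) : 0 <= s -> s <= t ->
    (t - s) * expR (- immigration_exponent Phi v t 1) <= occ t - occ s <=
    (t - s) * expR (- immigration_exponent Phi v s 1).
  by move=> s0 st; exact: (occupation_bounds vflow Phi_continuous Phi_ge0 s0 st).
have occ_nd (s t : R) : 0 <= s -> s <= t -> occ s <= occ t.
  move=> s0 st; have /andP[h _] := occ_bounds s t s0 st.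
  rewrite -subr_ge0; apply: le_trans h.
  by rewrite mulr_ge0 ?expR_ge0// subr_ge0.
have occI : (occ n%:R)%:E @[n --> \oo] --> I.
  exact: (occupation_cvg vflow Psi_continuous Phi_continuous Psi0 Psi_ratio Psi_gt0).
split=> HI.
  apply: (bottom_level_recurrent XP absorbed laplace vflow Phi_continuous Psi0
    Psi_ratio Psi_gt0 Phi_ge0 Phi_ratio occ_nd) => [s t s0 st|M].
    by have /andP[] := occ_bounds s t s0 st.
  move: occI; rewrite HI => /cvgey_ge/(_ M) [n _ /(_ n (leqnn n))] /=.
  by rewrite lee_fin; exists n.
have I0 : (0 <= I)%E.
  apply: integral_ge0 => z; rewrite /= in_itv/= => /andP[z0 _].
  by rewrite lee_fin mulr_ge0 ?expR_ge0// invr_ge0 ltW// Psi_gt0.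
have IE : I = (fine I)%:E by rewrite fineK// ge0_fin_numE.
have occK : occ n%:R @[n --> \oo] --> fine I.
  have h : (occ n%:R)%:E @[n --> \oo] --> (fine I)%:E by rewrite -IE.
  exact: (fine_cvg h).
have occ_le (t : R) : 0 <= t -> occ t <= fine I.
  move=> t0; rewrite -(cvg_lim _ occK)//; apply: limr_ge; first exact: cvgP occK.
  near=> n; apply: occ_nd => //; near: n; exact: nbhs_infty_ger.
apply: (occupation_transient XP absorbed cX laplace v_ge0 v_gt0 v_le1 _ _ occ_le occK).
  move=> s t s0 st.
  exact: (immigration_exponent_nondecreasing vflow Phi_continuous ltr01 Phi_ge0 s0 st).
by move=> s t s0 st; have /andP[] := occ_bounds s t s0 st.
Unshelve. all: by end_near. Qed.
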